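(* Let $n \geq 2$ and let $M^n$ be a closed, connected and oriented immersed hypersurface of the unit round sphere $\mathbb{S}^{n+1}$. Let $R \in (0,\pi)$ be the radius of the smallest geodesic ball of $\mathbb{S}^{n+1}$ containing $M$. If the principal curvatures $\lambda_1,\dots,\lambda_n$ of $M$ satisfy $$\inf_{p \in M} |\lambda_i(p)| > \tan\left(\frac{R}{2}\right), \quad \forall\, i \in \{1,\dots,n\},$$ then $M$ is diffeomorphic to $\mathbb{S}^n$.
   Context: $\mathbb{S}^{n+1} \subset \mathbb{R}^{n+2}$ is the unit sphere with its round metric of constant curvature $1$, and $d$ is its Riemannian (geodesic) distance. Closed means compact without boundary. The geodesic ball of radius $R$ centered at $p_0$ is $\{x : d(x,p_0) \le R\}$, and ''containing $M$'' means containing the image of the immersion. The principal curvatures at $p \in M$ are the eigenvalues of the shape operator $A_p(v) = -\overline{\nabla}_v \eta$, where $\eta$ is the unit normal field along $M$ giving its orientation and $\overline{\nabla}$ is the Riemannian connection of $\mathbb{S}^{n+1}$. *)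

(* Defs.v *)
From HB Require Import structures.
From mathcomp Require Export all_boot all_order all_algebra.
From mathcomp Require Export all_classical all_reals all_analysis.

Set Implicit Arguments.
Unset Strict Implicit.
Unset Printing Implicit Defensive.

Export Order.TTheory GRing.Theory Num.Theory.
Export numFieldNormedType.Exports.

Global Open Scope classical_set_scope.
Global Open Scope ring_scope.

(* The library norm of 'rV[R]_m is the sup norm, so the Euclidean structure
   is introduced separately; both induce the same topology. *)
Definition dot (R : realType) (m : nat) (u v : 'rV[R]_m) : R :=
  \sum_(i < m) u 0 i * v 0 i.

Definition enorm (R : realType) (m : nat) (u : 'rV[R]_m) : R :=
  Num.sqrt (dot u u).

Definition usphere (R : realType) (m : nat) : set 'rV[R]_m :=
  [set x | enorm x = 1].
Arguments usphere : clear implicits.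

(* C^k on an open subset U of a finite-dimensional space V: the directional
   derivatives include all partial derivatives. *)
Fixpoint Ck_on (R : realType) (V W : normedModType R) (k : nat) (U : set V)
    (f : V -> W) {struct k} : Prop :=
  match k with
  | 0 => forall x, U x -> {for x, continuous f}
  | k'.+1 => (forall x, U x -> differentiable f x) /\
             (forall v : V, Ck_on k' U (fun x => 'D_v f x))
  end.

Definition smooth_on (R : realType) (V W : normedModType R) (U : set V)
    (f : V -> W) : Prop :=
  forall k, Ck_on k U f.

(* [coord] and [par] are total functions, meaningful only on [dom] and on
   [coord @` dom], between which they are inverse homeomorphisms. *)
Record chart (R : realType) (n : nat) (T : topologicalType) := Chart {
  dom : set T;
  coord : T -> 'rV[R]_n;
  par : 'rV[R]_n -> T;
  dom_open : open dom;
  codom_open : open (coord @` dom);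
  coord_continuous_on : {within dom, continuous coord};
  par_continuous_on : {within coord @` dom, continuous par};
  coordK_on : forall p, dom p -> par (coord p) = p }.

(* Smooth n-manifolds without boundary, with a not necessarily maximal
   atlas. *)
Record smoothManifold (R : realType) (n : nat) := SmoothManifold {
  carrier :> topologicalType;
  atlas : set (chart R n carrier);
  manifold_hausdorff : hausdorff_space carrier;
  manifold_second_countable : @second_countable carrier;
  atlas_cover : forall p : carrier, exists2 c, atlas c & dom c p;
  atlas_compatible : forall c d, atlas c -> atlas d ->
    smooth_on (coord c @` (dom c `&` dom d)) (coord d \o par c) }.
Arguments atlas {R n}.

Definition smooth_map (R : realType) (n m : nat) (M : smoothManifold R n)
    (f : M -> 'rV[R]_m) : Prop :=
  forall c, atlas M c -> smooth_on (coord c @` dom c) (f \o par c).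

(* Derivative of f at p in the direction of the tangent vector whose
   coordinates in the chart c are v. *)
Definition chart_derive (R : realType) (n m : nat) (M : smoothManifold R n)
    (c : chart R n M) (f : M -> 'rV[R]_m) (p : M) (v : 'rV[R]_n) : 'rV[R]_m :=
  'D_v (f \o par c) (coord c p).

Definition immersion_in_sphere (R : realType) (n m : nat)
    (M : smoothManifold R n) (F : M -> 'rV[R]_m) : Prop :=
  [/\ forall p, usphere R m (F p),
      smooth_map F &
      forall c p, atlas M c -> dom c p ->
        forall v, chart_derive c F p v = 0 -> v = 0].

(* Unit normal field, inside the sphere, of the immersed hypersurface F. In the
   oriented sphere the choice of such a field amounts to an orientation of M. *)
Definition unit_normal_field (R : realType) (n : nat) (M : smoothManifold R n)
    (F eta : M -> 'rV[R]_n.+2) : Prop :=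
  [/\ smooth_map eta,
      forall p, enorm (eta p) = 1,
      forall p, dot (eta p) (F p) = 0 &
      forall c p, atlas M c -> dom c p ->
        forall v, dot (eta p) (chart_derive c F p v) = 0].

(* Orthogonal projection of the ambient space onto the tangent space at x of
   the unit sphere. *)
Definition sphere_tangent_part (R : realType) (m : nat) (x w : 'rV[R]_m) :
    'rV[R]_m :=
  w - dot w x *: x.

(* The Riemannian connection of the unit sphere, induced by the flat one of the
   ambient space: covariant derivative at p of a vector field X along F. *)
Definition sphere_covariant_derive (R : realType) (n m : nat)
    (M : smoothManifold R n) (c : chart R n M) (F X : M -> 'rV[R]_m) (p : M)
    (v : 'rV[R]_n) : 'rV[R]_m :=
  sphere_tangent_part (F p) (chart_derive c X p v).

(* A is the matrix, acting on coordinate row vectors v |-> v *m A, of the shape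
   operator at p; T_p M is identified with its image by the differential
   of F. *)
Definition shape_matrix (R : realType) (n : nat) (M : smoothManifold R n)
    (c : chart R n M) (F eta : M -> 'rV[R]_n.+2) (p : M) (A : 'M[R]_n) :
    Prop :=
  forall v : 'rV[R]_n,
    chart_derive c F p (v *m A) = - sphere_covariant_derive c F eta p v.

(* l lists the eigenvalues of the shape operator at p with multiplicity, in any
   order; different charts give similar matrices. *)
Definition principal_curvatures_at (R : realType) (n : nat)
    (M : smoothManifold R n) (F eta : M -> 'rV[R]_n.+2) (p : M)
    (l : 'I_n -> R) : Prop :=
  exists c (A : 'M[R]_n),
    [/\ atlas M c, dom c p, shape_matrix c F eta p A &
        char_poly A = \prod_(i < n) ('X - (l i)%:P)].

(* Curves parametrized by [0, 1] which coincide with smooth curves on the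
   successive intervals of a subdivision 0 < s_0 < ... < 1. *)
Definition piecewise_smooth (R : realType) (m : nat) (g : R -> 'rV[R]_m) :
    Prop :=
  exists s : seq R,
    [/\ path <%R 0 s, last 0 s = 1 &
        forall i, (i < size s)%N ->
          exists2 h : R -> 'rV[R]_m, smooth_on setT h &
            {in `[nth 0 (0 :: s) i, nth 0 s i], g =1 h}].

(* The derivative of a piecewise smooth curve is junk at finitely many points,
   which does not affect the integral. *)
Definition curve_length (R : realType) (m : nat) (g : R -> 'rV[R]_m) : R :=
  \int[@lebesgue_measure R]_(t in `[0, 1]) enorm (derive1 g t).

(* Riemannian distance of the submanifold S of the Euclidean space. *)
Definition geodesic_dist (R : realType) (m : nat) (S : set 'rV[R]_m)
    (x y : 'rV[R]_m) : R :=
  inf [set L : R | exists g : R -> 'rV[R]_m,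
        [/\ piecewise_smooth g,
            forall t, t \in `[0, 1] -> S (g t),
            g 0 = x, g 1 = y & L = curve_length g]].

Definition geodesic_ball (R : realType) (m : nat) (p0 : 'rV[R]_m) (r : R) :
    set 'rV[R]_m :=
  [set x | usphere R m x /\ geodesic_dist (usphere R m) x p0 <= r].

Definition smallest_ball_radius (R : realType) (m : nat) (A : set 'rV[R]_m)
    (r : R) : Prop :=
  (exists2 p0, usphere R m p0 & A `<=` geodesic_ball p0 r) /\
  (forall q s, usphere R m q -> A `<=` geodesic_ball q s -> r <= s).

(* Smooth maps from an embedded submanifold S of the Euclidean space to M: they
   have local smooth extensions in coordinates. *)
Definition smooth_map_from (R : realType) (n m : nat) (S : set 'rV[R]_m)
    (M : smoothManifold R n) (g : 'rV[R]_m -> M) : Prop :=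
  forall c y, atlas M c -> S y -> dom c (g y) ->
    exists (U : set 'rV[R]_m) (h : 'rV[R]_m -> 'rV[R]_n),
      [/\ open U, U y, smooth_on U h &
          forall z, U z -> S z -> dom c (g z) /\ coord c (g z) = h z].

(* Diffeomorphism with the embedded submanifold S of the Euclidean space; only
   the restriction of g to S matters. *)
Definition diffeomorphic_to (R : realType) (n m : nat) (M : smoothManifold R n)
    (S : set 'rV[R]_m) : Prop :=
  exists (f : M -> 'rV[R]_m) (g : 'rV[R]_m -> M),
    [/\ (forall p, S (f p)) /\ smooth_map f,
        smooth_map_from S g,
        forall p, g (f p) = p &
        forall y, S y -> f (g y) = y].

(* Main.v *)
From HB Require Import structures.
Require Import Defs.
From mathcomp Require Import measurable_realfun ring lra.

Set Implicit Arguments.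
Unset Strict Implicit.
Unset Printing Implicit Defensive.

(** Let y be the center of the ball, so that M, seen in the sphere through F,
  stays at distance at most rho < pi from y, and transport the unit normal
  eta(p) to y, parallel along the minimizing geodesic from F(p).  The result

    G(p) = eta(p) - h(p) (F(p) + y),   h(p) = (eta(p).y) / (1 + F(p).y),

  is a unit vector orthogonal to y, that is, a point of the unit sphere of the
  tangent space at y, a sphere of dimension n.  A computation shows that, up to
  the transport, dG = - (A + h(p) Id), where A is the shape operator.  If r is the
  distance from F(p) to y, the component of y tangent to the sphere at F(p) has
  norm sin r, hence |h(p)| <= sin r / (1 + cos r) = tan (r / 2)
  <= tan (rho / 2) < |lambda_i|, so - h(p) is not an eigenvalue of A and G is
  an immersion between manifolds of the same dimension
  (half_angle_bound, transported_normal_immersive).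

  A local diffeomorphism G from a compact connected manifold to a sphere of
  dimension n >= 2 is a diffeomorphism, because the sphere is simply connected.
  Coverings are avoided: sections of G that exist locally, on caps of a
  uniform size by compactness, are continued along chords issued from a point
  G(p) to the complement of a small cap about - G(p), and then over this cap,
  because the annulus where the two definitions must agree is connected when
  n >= 2.  The global section is inverse to G by uniqueness of lifts and
  connectedness of M (local_homeo_sphere_bijective).

  The local sections come from the inverse function theorem (inverse_function),
  proved with the Newton map x |-> x - (Phi(x) - y) B.  It is applied to the
  cone map (t, u) |-> t G(u), between spaces of the same dimension n + 1, which
  avoids charts of the sphere and yields at once the smooth extensions to the
  ambient space that smoothness of the inverse demands (local_smooth_inverse).

  It remains to read the geometry of balls off the definition of the distance by
  lengths of curves (geodesic_ball_cap): along a curve g on the sphere, the angle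
  from g to y varies at most as fast as the arc length. *)

(** * C^k maps between normed spaces *)

Section Smooth.
Context {R : realType}.
Implicit Types (V W : normedModType R) (k m n : nat).

Lemma Ck_onS V W k (U : set V) (f : V -> W) : Ck_on k.+1 U f -> Ck_on k U f.
Proof.
elim: k f => [|k IH] f /= [df Hf].
  by move=> x Ux; exact/differentiable_continuous/df.
by split=> // v; apply: IH.
Qed.

Lemma Ck_on_sub V W k (U U' : set V) (f : V -> W) :
  U' `<=` U -> Ck_on k U f -> Ck_on k U' f.
Proof.
move=> sU; elim: k f => [|k IH] f /=; first by move=> H x /sU /H.
by move=> [df Hf]; split=> [x /sU /df //|v]; apply: IH.
Qed.

Lemma near_open V (U : set V) (P : V -> Prop) x :
  open U -> U x -> (forall y, U y -> P y) -> \near x, P x.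
Proof.
move=> oU Ux H; apply: (@filterS _ _ _ U) => //; exact: open_nbhs_nbhs.
Qed.

(** The Landau notation of the differential, spelled out with epsilons.  The next
  lemma is the converse, which also identifies the differential. *)
Lemma differentiable_approx V W (f : V -> W) x : differentiable f x ->
  forall e : R, 0 < e ->
    \forall h \near 0, `|f (h + x) - f x - 'd f x h| <= e * `|h|.
Proof.
move=> /diff_locally /eqaddoP H e /H; apply: filterS => h.
by rewrite /= !fctE opprD addrA.
Qed.

Lemma approx_differentiable V W (f : V -> W) (df : {linear V -> W}) x :
  continuous df ->
  (forall e : R, 0 < e ->
    \forall h \near 0, `|f (h + x) - f x - df h| <= e * `|h|) ->
  differentiable f x /\ 'd f x = df :> (V -> W).
Proof.
move=> cdf H.
have fE : f \o shift x = cst (f x) + df +o_ 0 id.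
  apply/eqaddoP => e /H; apply: filterS => h.
  by rewrite /= !fctE opprD addrA.
have dE := diff_unique cdf fE.
by split=> //; apply/diff_locallyP; rewrite dE.
Qed.

Lemma near_eq_differentiable V W (f g : V -> W) x :
  (\near x, f x = g x) -> differentiable f x -> differentiable g x.
Proof.
move=> fg df; apply: (proj1 (approx_differentiable (df := 'd f x) _ _)).
  exact: diff_continuous.
move=> e /(differentiable_approx df) H.
have fg0 : \forall h \near 0, f (h + x) = g (h + x).
  by move/nbhs0P: fg; apply: filterS => h; rewrite addrC.
near=> h.
have <- : f (h + x) = g (h + x) by near: h.
rewrite -(nbhs_singleton fg); near: h; exact: H.
Unshelve. all: by end_near. Qed.

(** The iterated derivatives at a point of an open set only depend on the values
  on that set; this is what lets derivatives be computed by formulas that hold on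
  U alone. *)
Lemma eq_Ck_on V W k (U : set V) (f g : V -> W) :
  open U -> {in U, f =1 g} -> Ck_on k U f -> Ck_on k U g.
Proof.
move=> oU; elim: k f g => [|k IH] f g fg /=.
  move=> H x Ux; have := H x Ux.
  rewrite /prop_for /continuous_at -(fg x (mem_set Ux)); apply: cvg_trans.
  apply: near_eq_cvg; apply: near_open oU Ux _ => y Uy.
  by rewrite fg ?inE.
move=> [df Hf]; split=> [x Ux|v].
  apply: near_eq_differentiable (df x Ux).
  by apply: near_open oU Ux _ => y Uy; rewrite fg ?inE.
apply: IH (Hf v) => x; rewrite inE => Ux; apply: near_eq_derive.
by apply: near_open oU Ux _ => y Uy; rewrite fg ?inE.
Qed.

Lemma derive_comp V V' W (f : V -> V') (g : V' -> W) x v :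
  differentiable f x -> differentiable g (f x) ->
  'D_v (g \o f) x = 'D_('D_v f x) g (f x).
Proof.
move=> df dg; rewrite [LHS]deriveE; last exact: differentiable_comp.
by rewrite [RHS]deriveE // [in RHS]deriveE // diff_comp.
Qed.

Lemma Ck_on_cst V W k (U : set V) (a : W) : Ck_on k U (cst a).
Proof.
elim: k a => [|k IH] a /=; first by move=> x _; exact: cst_continuous.
split=> [x _|v]; first exact: differentiable_cst.
rewrite (_ : (fun x => _) = cst 0) //.
by apply/funext => x; rewrite derive_cst.
Qed.

Lemma Ck_on_add V W k (U : set V) (f g : V -> W) : open U ->
  Ck_on k U f -> Ck_on k U g -> Ck_on k U (fun x => f x + g x).
Proof.
move=> oU; elim: k f g => [|k IH] f g /=.
  by move=> Hf Hg x Ux; apply: cvgD; [exact: Hf|exact: Hg].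
move=> [df Hf] [dg Hg]; split=> [x Ux|v].
  by apply: differentiableD; [exact: df|exact: dg].
apply: eq_Ck_on (IH _ _ (Hf v) (Hg v)) => // x; rewrite inE => Ux.
by rewrite deriveD //; apply: diff_derivable; [exact: df|exact: dg].
Qed.

(** By the Leibniz rule, f * g has derivatives of the same form, with one order
  less to spare, so the induction runs over both factors at once. *)
Lemma Ck_on_mul V k (U : set V) (f g : V -> R) : open U ->
  Ck_on k U f -> Ck_on k U g -> Ck_on k U (fun x => f x * g x).
Proof.
move=> oU; elim: k f g => [|k IH] f g /=.
  by move=> Hf Hg x Ux; apply: cvgM; [exact: Hf|exact: Hg].
move=> CSf CSg; have Cf := Ck_onS CSf; have Cg := Ck_onS CSg.
move: CSf CSg => [df Hf] [dg Hg]; split=> [x Ux|v].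
  by apply: differentiableM; [exact: df|exact: dg].
apply: eq_Ck_on (Ck_on_add oU (IH _ _ Cf (Hg v)) (IH _ _ Cg (Hf v))) => // x.
rewrite inE => Ux.
by rewrite deriveM //; apply: diff_derivable; [exact: df|exact: dg].
Qed.

Lemma Ck_on_opp V W k (U : set V) (f : V -> W) : open U ->
  Ck_on k U f -> Ck_on k U (fun x => - f x).
Proof.
move=> oU; elim: k f => [|k IH] f /=.
  by move=> Hf x Ux; apply: cvgN; exact: Hf.
move=> [df Hf]; split=> [x Ux|v]; first by apply: differentiableN; exact: df.
apply: eq_Ck_on (IH _ (Hf v)) => // x; rewrite inE => Ux.
by rewrite deriveN //; apply: diff_derivable; exact: df.
Qed.

(** The derivative of 1/f is - f'/f^2, a product of f' and of inverses that the
  induction hypothesis covers. *)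
Lemma Ck_on_inv V k (U : set V) (f : V -> R) : open U ->
  (forall x, U x -> f x != 0) ->
  Ck_on k U f -> Ck_on k U (fun x => (f x)^-1).
Proof.
move=> oU f0; elim: k => [|k IH] /=.
  by move=> Hf x Ux; apply: cvgV; [exact: f0|exact: Hf].
move=> CSf; have Cf := IH (Ck_onS CSf); move: CSf => [df Hf].
split=> [x Ux|v]; first by apply: differentiableV; [exact: df|exact: f0].
apply: eq_Ck_on (Ck_on_opp oU (Ck_on_mul oU (Ck_on_mul oU Cf Cf) (Hf v))) => // x.
rewrite inE => Ux; rewrite deriveV ?f0 //; last exact/diff_derivable/df.
by rewrite /= -expr2 exprVn -mulNr.
Qed.

Lemma Ck_on_sum V W k (U : set V) (I : Type) (r : seq I) (P : pred I)
    (f : I -> V -> W) : open U ->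
  (forall i, P i -> Ck_on k U (f i)) ->
  Ck_on k U (fun x => \sum_(i <- r | P i) f i x).
Proof.
move=> oU Hf; elim: r => [|i r IH].
  by under eq_fun => x do rewrite big_nil; exact: Ck_on_cst.
have [Pi|nPi] := boolP (P i).
  rewrite (_ : (fun x => _) = fun x => f i x + \sum_(j <- r | P j) f j x).
    by apply: Ck_on_add => //; exact: Hf.
  by apply/funext => x; rewrite big_cons Pi.
rewrite (_ : (fun x => _) = fun x => \sum_(j <- r | P j) f j x) //.
by apply/funext => x; rewrite big_cons (negbTE nPi).
Qed.

Lemma Ck_on_prod V k (U : set V) (I : Type) (r : seq I) (P : pred I)
    (f : I -> V -> R) : open U ->
  (forall i, P i -> Ck_on k U (f i)) ->
  Ck_on k U (fun x => \prod_(i <- r | P i) f i x).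
Proof.
move=> oU Hf; elim: r => [|i r IH].
  by under eq_fun => x do rewrite big_nil; exact: Ck_on_cst.
have [Pi|nPi] := boolP (P i).
  rewrite (_ : (fun x => _) = fun x => f i x * \prod_(j <- r | P j) f j x).
    by apply: Ck_on_mul => //; exact: Hf.
  by apply/funext => x; rewrite big_cons Pi.
rewrite (_ : (fun x => _) = fun x => \prod_(j <- r | P j) f j x) //.
by apply/funext => x; rewrite big_cons (negbTE nPi).
Qed.

(** Expanding along the basis reduces maps to row vectors to scalar functions, for
  which products and inverses are available. *)
Lemma differentiable_coordwise V m (f : V -> 'rV[R]_m) x :
  (forall j, differentiable (fun y => f y 0 j) x) -> differentiable f x.
Proof.
move=> df; rewrite (_ : f = fun y => \sum_j f y 0 j *: delta_mx 0 j); last first.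
  by apply/funext => y; exact: row_sum_delta.
rewrite (_ : (fun y => _) = \sum_j (fun y => f y 0 j *: delta_mx 0 j)); last first.
  by apply/funext => y; rewrite fct_sumE.
by apply: differentiable_sum => j; exact: differentiableZl.
Qed.

Lemma differentiable_coord1 V m (f : V -> 'rV[R]_m) x j :
  differentiable f x -> differentiable (fun y => f y 0 j) x.
Proof.
move=> df; apply: (differentiable_comp (g := fun u : 'rV[R]_m => u 0 j)) => //.
exact: differentiable_coord.
Qed.

Lemma derive_coord V m (f : V -> 'rV[R]_m) x v j : differentiable f x ->
  'D_v f x 0 j = 'D_v (fun y => f y 0 j) x.
Proof. by move=> df; rewrite derive_mx ?mxE //; exact: diff_derivable. Qed.

Lemma Ck_on_coord V m k (U : set V) (f : V -> 'rV[R]_m) j : open U ->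
  Ck_on k U f -> Ck_on k U (fun x => f x 0 j).
Proof.
move=> oU; elim: k f => [|k IH] f /=.
  move=> Hf x Ux; apply: (continuous_comp (g := fun u : 'rV[R]_m => u 0 j)).
    exact: Hf.
  exact: coord_continuous.
move=> [df Hf]; split=> [x Ux|v]; first exact/differentiable_coord1/df.
apply: eq_Ck_on (IH _ (Hf v)) => // x; rewrite inE => Ux.
by rewrite derive_coord //; exact: df.
Qed.

Lemma Ck_on_coordwise V m k (U : set V) (f : V -> 'rV[R]_m) : open U ->
  (forall j, Ck_on k U (fun x => f x 0 j)) -> Ck_on k U f.
Proof.
move=> oU; elim: k f => [|k IH] f /= Hf.
  rewrite (_ : f = fun y => \sum_j f y 0 j *: delta_mx 0 j); last first.
    by apply/funext => y; exact: row_sum_delta.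
  apply: (@Ck_on_sum _ _ 0) => // j _ x Ux.
  by apply: cvgZr_tmp; exact: Hf.
have df x : U x -> differentiable f x.
  by move=> Ux; apply: differentiable_coordwise => j; have [+ _] := Hf j; exact.
split=> // v; apply: IH => j; have [_ /(_ v)] := Hf j.
apply: eq_Ck_on => // x; rewrite inE => Ux.
by rewrite derive_coord //; exact: df.
Qed.

Lemma derive_sum_delta m W (g : 'rV[R]_m -> W) x v : differentiable g x ->
  'D_v g x = \sum_j v 0 j *: 'D_(delta_mx 0 j) g x.
Proof.
move=> dg; rewrite deriveE // {1}(row_sum_delta v) linear_sum.
by apply: eq_bigr => j _; rewrite linearZ deriveE.
Qed.

(** By the chain rule the derivative of g o f is a sum of products of coordinates
  of f' and of partial derivatives of g composed with f; finite dimension of the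
  middle space is what makes this sum available. *)
Lemma Ck_on_compR V m k (U : set V) (U' : set 'rV[R]_m) (f : V -> 'rV[R]_m)
    (g : 'rV[R]_m -> R) :
  open U -> (forall x, U x -> U' (f x)) ->
  Ck_on k U f -> Ck_on k U' g -> Ck_on k U (g \o f).
Proof.
move=> oU fU; elim: k f g fU => [|k IH] f g fU /=.
  by move=> Hf Hg x Ux; apply: continuous_comp; [exact: Hf|exact/Hg/fU].
move=> CSf; have Cf := Ck_onS CSf; move: CSf => [df Hf] [dg Hg].
split=> [x Ux|v].
  by apply: differentiable_comp; [exact: df|exact/dg/fU].
have : Ck_on k U (fun x => \sum_j 'D_v f x 0 j * ('D_(delta_mx 0 j) g \o f) x).
  apply: Ck_on_sum => // j _; apply: Ck_on_mul => //.
    exact: Ck_on_coord.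
  by apply: IH => //.
apply: eq_Ck_on => // x; rewrite inE => Ux.
rewrite [RHS](derive_comp _ (df _ Ux) (dg _ (fU _ Ux))).
by rewrite [RHS]derive_sum_delta; last exact/dg/fU.
Qed.

Lemma Ck_on_comp V m n k (U : set V) (U' : set 'rV[R]_m) (f : V -> 'rV[R]_m)
    (g : 'rV[R]_m -> 'rV[R]_n) :
  open U -> open U' -> (forall x, U x -> U' (f x)) ->
  Ck_on k U f -> Ck_on k U' g -> Ck_on k U (g \o f).
Proof.
move=> oU oU' fU Cf Cg; apply: Ck_on_coordwise => // j.
by apply: (@Ck_on_compR _ _ _ U U' f (fun y => g y 0 j)) => //; exact: Ck_on_coord.
Qed.

Lemma differentiable_id (V : normedModType R) (x : V) : differentiable id x.
Proof. exact: ex_diff. Qed.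

Lemma Ck_on_id V k (U : set V) : Ck_on k U id.
Proof.
case: k => [|k]; first by move=> x _; exact: cvg_id.
split=> [x _|v]; first exact: differentiable_id.
rewrite (_ : (fun x => _) = cst v); first exact: Ck_on_cst.
by apply/funext => x; rewrite derive_id.
Qed.

Lemma Ck_on_scale V m k (U : set V) (a : V -> R) (f : V -> 'rV[R]_m) : open U ->
  Ck_on k U a -> Ck_on k U f -> Ck_on k U (fun x => a x *: f x).
Proof.
move=> oU Ca Cf; apply: Ck_on_coordwise => // j.
have := Ck_on_mul oU Ca (Ck_on_coord j oU Cf).
by apply: eq_Ck_on => // x _; rewrite mxE.
Qed.

Lemma derive_scale V m (a : V -> R) (f : V -> 'rV[R]_m) x v :
  differentiable a x -> differentiable f x ->
  differentiable (fun y => a y *: f y) x /\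
  'D_v (fun y => a y *: f y) x = 'D_v a x *: f x + a x *: 'D_v f x.
Proof.
move=> da df; have dc j := differentiable_coord1 j df.
have daf : differentiable (fun y => a y *: f y) x.
  apply: differentiable_coordwise => j.
  rewrite (_ : (fun y => _) = a * (fun y => f y 0 j)).
    exact: differentiableM da (dc j).
  by apply/funext => y; rewrite !mxE.
split=> //; apply/rowP => j; rewrite derive_coord // !mxE derive_coord //.
rewrite (_ : (fun y => _) = a * (fun y => f y 0 j)).
  rewrite (deriveM (diff_derivable da) (diff_derivable (dc j))).
  by rewrite /GRing.scale /=; ring.
by apply/funext => y; rewrite !mxE.
Qed.

Lemma Ck_on_det (V : normedModType R) n k (U : set V) (A : V -> 'M[R]_n) :
  open U -> (forall i j, Ck_on k U (fun x => A x i j)) ->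
  Ck_on k U (fun x => \det (A x)).
Proof.
move=> oU H; apply: Ck_on_sum => // s _; apply: Ck_on_mul => //.
  exact: Ck_on_cst.
by apply: Ck_on_prod => // i _.
Qed.

(** Cramer: the entries of the inverse matrix are rational in the entries. *)
Lemma Ck_on_mulmx_inv (V : normedModType R) n k (U : set V) (A : V -> 'M[R]_n)
    (v : 'rV[R]_n) :
  open U -> (forall x, U x -> A x \in unitmx) ->
  (forall i j, Ck_on k U (fun x => A x i j)) ->
  Ck_on k U (fun x => v *m invmx (A x)).
Proof.
move=> oU uA H; apply: Ck_on_coordwise => // j.
have : Ck_on k U (fun x => \sum_i v 0 i * ((\det (A x))^-1 * cofactor (A x) j i)).
  apply: Ck_on_sum => // i _; apply: Ck_on_mul => //; first exact: Ck_on_cst.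
  apply: Ck_on_mul => //.
    apply: Ck_on_inv => //; last exact: Ck_on_det.
    by move=> x /uA; rewrite unitmxE unitfE.
  apply: Ck_on_mul => //; first exact: Ck_on_cst.
  apply: Ck_on_det => // a b.
  rewrite (_ : (fun x => _) = fun x => A x (lift j a) (lift i b)) //.
  by apply/funext => x; rewrite !mxE.
apply: eq_Ck_on => // x; rewrite inE => /uA Au.
by rewrite mxE; apply: eq_bigr => i _; rewrite /invmx Au !mxE.
Qed.

Lemma Ck_on_mulmxr (V : normedModType R) m n k (U : set V) (f : V -> 'rV[R]_m)
    (B : 'M[R]_(m, n)) :
  open U -> Ck_on k U f -> Ck_on k U (fun x => f x *m B).
Proof.
move=> oU Cf; apply: Ck_on_coordwise => // j.
rewrite (_ : (fun x => _) = fun x => \sum_i f x 0 i * B i j).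
  apply: Ck_on_sum => // i _; apply: Ck_on_mul => //; first exact: Ck_on_coord.
  exact: Ck_on_cst.
by apply/funext => x; rewrite mxE.
Qed.

Lemma continuous_mulmxr m n (B : 'M[R]_(m, n)) :
  continuous (fun u : 'rV[R]_m => u *m B).
Proof.
move=> u.
apply: (@Ck_on_mulmxr _ m n 0 setT id B openT _ u I) => x _.
exact: cvg_id.
Qed.

Lemma derive_mulmxr (V : normedModType R) m n (f : V -> 'rV[R]_m)
    (B : 'M[R]_(m, n)) x : differentiable f x ->
  differentiable (fun y => f y *m B) x /\
  (forall v, 'D_v (fun y => f y *m B) x = 'D_v f x *m B).
Proof.
move=> df; pose L : {linear 'rV[R]_m -> 'rV[R]_n} := mulmxr B.
have cL : continuous L := @continuous_mulmxr _ _ B.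
have dL := linear_differentiable (f x) cL.
split=> [|v]; first exact: (differentiable_comp df dL).
apply: etrans (derive_comp v df dL) _.
by rewrite deriveE // diff_lin.
Qed.

End Smooth.

(** * The inverse function theorem *)

(** Joins the complete and the normed structures of matrices, so that the Banach
  fixed point theorem applies to row vectors. *)
HB.instance Definition _ (R : realType) (m n : nat) := Complete.on 'M[R]_(m, n).

Section InverseFunction.
Context {R : realType}.

Lemma mx_norm_coord m (u : 'rV[R]_m) j : `|u 0 j| <= `|u|.
Proof.
rewrite [leRHS]/Num.Def.normr/= mx_normrE.
exact: (le_bigmax _ (fun ij : 'I_1 * 'I_m => `|u ij.1 ij.2|) (0, j)).
Qed.

Lemma mx_norm_le m (u : 'rV[R]_m) (c : R) : 0 <= c ->
  (forall j, `|u 0 j| <= c) -> `|u| <= c.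
Proof.
move=> c0 H; rewrite [leLHS]/Num.Def.normr/= mx_normrE.
by apply: bigmax_le => // -[i j] _; rewrite ord1 /=.
Qed.

Lemma ball_segment (V : normedModType R) (a x y : V) (r t : R) :
  ball a r x -> ball a r y -> 0 <= t <= 1 -> ball a r (x + t *: (y - x)).
Proof.
rewrite -!ball_normE /= => ax ay /andP[t0 t1].
have -> : a - (x + t *: (y - x)) = (1 - t) *: (a - x) + t *: (a - y).
  have -> : y - x = (a - x) - (a - y) by rewrite opprB [RHS]addrC subrKA.
  rewrite opprD addrA; set u := a - x; set w := a - y.
  by rewrite scalerBl scale1r scalerBr opprB addrA [RHS]addrAC.
apply: le_lt_trans (ler_normD _ _) _; rewrite !normrZ ger0_norm ?subr_ge0 //.
rewrite (ger0_norm t0).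
have [->|t1'] := eqVneq t 1; first by rewrite subrr mul0r add0r mul1r.
have t1'' : 0 < 1 - t by rewrite subr_gt0 lt_neqAle t1' t1.
rewrite [ltRHS](_ : r = (1 - t) * r + t * r); last by ring.
by rewrite ltr_leD // ?ltr_pM2l // ler_wpM2l // ltW.
Qed.

Lemma is_derive_line (V : normedModType R) (x w : V) (t : R) :
  is_derive t 1 (fun s : R => x + s *: w) w.
Proof.
have [ds sE] := @is_diff_scalel R V t w.
have dl : is_derive t 1 ( *:%R^~ w) w.
  apply: DeriveDef; first exact: diff_derivable.
  by rewrite deriveE // sE scale1r.
by rewrite -[X in is_derive _ _ _ X]add0r; exact: is_deriveD.
Qed.

(** For the sup norm, the mean value inequality follows coordinate by coordinate
  from the scalar mean value theorem along the segment. *)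
Lemma lipschitz_of_derive m (g : 'rV[R]_m -> 'rV[R]_m) a (r q : R) : 0 <= q ->
  (forall x, ball a r x -> differentiable g x) ->
  (forall x v, ball a r x -> `|'D_v g x| <= q * `|v|) ->
  forall x y, ball a r x -> ball a r y -> `|g y - g x| <= q * `|y - x|.
Proof.
move=> q0 dg Dg x y ax ay; apply: mx_norm_le => [|j]; first exact: mulr_ge0.
pose c t := x + t *: (y - x).
have dc (t : R) : is_derive t 1 c (y - x) by exact: is_derive_line.
have cb t : 0 <= t <= 1 -> ball a r (c t) by move=> ?; exact: ball_segment.
have dgc (t : R) : 0 <= t <= 1 ->
    is_derive t 1 (fun t => g (c t) 0 j) ('D_(y - x) g (c t) 0 j).
  move=> t01; have dct : differentiable c t.
    by apply/derivable1_diffP; have [] := dc t.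
  have dgct := differentiable_comp dct (dg _ (cb _ t01)).
  apply: DeriveDef; first exact/diff_derivable/differentiable_coord1.
  apply: etrans (esym (derive_coord (1 : R) j dgct)) _; congr (fun_of_matrix _ 0 j).
  apply: etrans (derive_comp (1 : R) dct (dg _ (cb _ t01))) _.
  by rewrite (@derive_val _ _ _ _ _ _ _ (dc t)).
have Hd (t : R) : t \in `]0, 1[ ->
    is_derive t 1 (fun t => g (c t) 0 j) ('D_(y - x) g (c t) 0 j).
  by rewrite in_itv /= => /andP[/ltW t0 /ltW t1]; apply/dgc/andP.
have Hc : {within `[0, 1], continuous (fun t => g (c t) 0 j)}.
  apply: derivable_within_continuous => t; rewrite in_itv /= => t01.
  by have [] := dgc t t01.
have [t t01] := MVT_segment ler01 Hd Hc.
rewrite subr0 mulr1 /c scale1r scale0r addr0 subrKC => e.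
rewrite !mxE e; apply: le_trans (mx_norm_coord _ _) _.
by apply: Dg; apply: cb; move: t01; rewrite in_itv.
Qed.

Lemma bounded_mulmx m n (B : 'M[R]_(m, n)) :
  exists2 K : R, 0 < K & forall u : 'rV[R]_m, `|u *m B| <= K * `|u|.
Proof.
exists (1 + \sum_i \sum_j `|B i j|).
  by rewrite ltr_wpDr // !sumr_ge0 // => i _; rewrite sumr_ge0.
move=> u; apply: mx_norm_le => [|j].
  by rewrite mulr_ge0 // addr_ge0 // sumr_ge0 // => i _; rewrite sumr_ge0.
rewrite mxE; apply: le_trans (ler_norm_sum _ _ _) _.
apply: (@le_trans _ _ (\sum_i `|u| * \sum_j0 `|B i j0|)).
  apply: ler_sum => i _; rewrite normrM ler_pM // ?mx_norm_coord //.
  by rewrite (bigD1 j) //= lerDl sumr_ge0.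
by rewrite -mulr_sumr mulrC ler_wpM2r // lerDr.
Qed.

Lemma near_norm_le (V W : normedModType R) (h : V -> W) a (e : R) : 0 < e ->
  {for a, continuous h} -> h a = 0 -> \near a, `|h a| <= e.
Proof.
move=> e0 /cvgrPdist_lt /(_ _ e0) H h0; apply: filterS H => x.
by rewrite h0 sub0r normrN => /ltW.
Qed.

Lemma norm_near0 (V : normedModType R) (e : R) : 0 < e ->
  \forall h \near (0 : V), `|h| < e.
Proof.
move=> e0; apply/nbhs_ballP; exists e => // h.
by rewrite -ball_normE /= sub0r normrN.
Qed.

Lemma jacobian_unit m (Phi : 'rV[R]_m -> 'rV[R]_m) x :
  differentiable Phi x -> (forall v, 'D_v Phi x = 0 -> v = 0) ->
  jacobian Phi x \in unitmx.
Proof.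
move=> dPhi inj; rewrite -row_free_unit -kermx_eq0; apply/rowV0P => v.
by move=> /sub_kermxP vJ; apply: inj; rewrite deriveEjacobian.
Qed.

(** B is the inverse of the Jacobian at a, so the differential of the Newton map
  x |-> x - Phi(x) B vanishes at a; it stays small around a by continuity. *)
Lemma newton_contraction m (Om : set 'rV[R]_m) (Phi : 'rV[R]_m -> 'rV[R]_m) a :
  open Om -> Om a -> Ck_on 1 Om Phi -> (forall v, 'D_v Phi a = 0 -> v = 0) ->
  exists B : 'M[R]_m, exists2 r : R, 0 < r & [/\ B \in unitmx, ball a r `<=` Om &
    forall x v, ball a r x -> `|v - 'D_v Phi x *m B| <= 2^-1 * `|v|].
Proof.
move=> oOm Oma [dPhi cPhi] inj.
have Ju : jacobian Phi a \in unitmx by apply: jacobian_unit => //; exact: dPhi.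
pose B : 'M[R]_m := invmx (jacobian Phi a); exists B.
(* By multilinearity it is enough to bound the derivatives along the basis; the
  successor in m.+1 keeps the bound meaningful when m = 0. *)
have N0 : 0 < 2^-1 / m.+1%:R :> R by rewrite divr_gt0.
have near_small : \near a, forall j : 'I_m,
    `|delta_mx 0 j - 'D_(delta_mx 0 j) Phi a *m B| <= 2^-1 / m.+1%:R.
  apply: (@filter_forall _ _ (fun (j : 'I_m) (x : 'rV[R]_m) => is_true
    (`|delta_mx 0 j - 'D_(delta_mx 0 j) Phi x *m B| <= 2^-1 / m.+1%:R))
    _ (@nbhs_filter _ a)) => j.
  have C0 := Ck_on_add oOm (Ck_on_cst 0 Om (delta_mx 0 j : 'rV[R]_m))
    (Ck_on_opp oOm (Ck_on_mulmxr B oOm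
      (cPhi (delta_mx 0 j) : Ck_on 0 Om ('D_(delta_mx 0 j) Phi)))).
  have Ea : delta_mx 0 j - 'D_(delta_mx 0 j) Phi a *m B = 0.
    by rewrite (deriveEjacobian _ (dPhi _ Oma)) mulmxK // subrr.
  exact: (near_norm_le N0 (C0 a Oma) Ea).
have [r r0 Hr] : exists2 r : R, 0 < r & ball a r `<=` Om `&` [set a |
    forall j : 'I_m, `|delta_mx 0 j - 'D_(delta_mx 0 j) Phi a *m B| <= 2^-1 / m.+1%:R].
  apply/nbhs_ballP; apply: filterI near_small.
  exact: open_nbhs_nbhs.
exists r => //; split; first by rewrite unitmx_inv.
  by move=> x /Hr [].
move=> x v /Hr [Ox Hx].
rewrite derive_sum_delta; last exact: dPhi.
rewrite {1}(row_sum_delta v) mulmx_suml -sumrB.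
apply: le_trans (ler_norm_sum _ _ _) _.
apply: (@le_trans _ _ (\sum_(j < m) `|v| * (2^-1 / m.+1%:R))).
  apply: ler_sum => j _; rewrite -scalemxAl -scalerBr normrZ.
  by rewrite ler_pM // mx_norm_coord.
rewrite sumr_const card_ord -(mulr_natr (_ * _)).
rewrite -mulrA mulrC ler_wpM2r // -mulrA ger_pMr // ?invr_gt0 //.
by rewrite ler_pdivrMl // mulr1 ler_nat.
Qed.

(** Hence the Newton map is 1/2-Lipschitz on the whole ball; this gives both the
  existence of preimages under Phi and a Lipschitz bound for its inverse. *)
Lemma newton_lipschitz m (Phi : 'rV[R]_m -> 'rV[R]_m) (B : 'M[R]_m) a (r : R) :
  (forall x, ball a r x -> differentiable Phi x) ->
  (forall x v, ball a r x -> `|v - 'D_v Phi x *m B| <= 2^-1 * `|v|) ->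
  forall x y, ball a r x -> ball a r y ->
  `|(y - Phi y *m B) - (x - Phi x *m B)| <= 2^-1 * `|y - x|.
Proof.
move=> dPhi H.
apply: (@lipschitz_of_derive _ (fun x => x - Phi x *m B) a r 2^-1).
  by rewrite invr_ge0.
  move=> x /dPhi /(derive_mulmxr B) [dB _].
  exact: (differentiableB (differentiable_id x) dB).
move=> x v ax; have [dB DB] := derive_mulmxr B (dPhi x ax).
have -> : 'D_v (fun x => x - Phi x *m B) x = v - 'D_v Phi x *m B; last exact: H.
apply: etrans (deriveB (diff_derivable (differentiable_id x)) (diff_derivable dB)) _.
by rewrite derive_id DB.
Qed.

(** The Banach fixed point of x |-> x - (Phi x - y) B solves Phi x = y. *)
Lemma newton_solution m (Phi : 'rV[R]_m -> 'rV[R]_m) (B : 'M[R]_m) a (r : R) y :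
  0 < r -> B \in unitmx ->
  (forall x x', ball a r x -> ball a r x' ->
    `|(x' - Phi x' *m B) - (x - Phi x *m B)| <= 2^-1 * `|x' - x|) ->
  `|(y - Phi a) *m B| < r / 4 ->
  exists2 x, ball a r x & Phi x = y.
Proof.
move=> r0 uB lip yr; pose r2 := r / 2.
have r20 : 0 < r2 by rewrite divr_gt0.
(* The Newton map preserves the closed ball of radius r / 2: it moves its center
  by less than r / 4 and contracts distances to the center by 1 / 2. *)
pose C : set 'rV[R]_m := closed_ball a r2.
have CE x : C x = (`|a - x| <= r2) :> Prop by rewrite /C closed_ballE.
have Cb x : C x -> ball a r x.
  rewrite CE -ball_normE /= => H; apply: le_lt_trans H _.
  by rewrite /r2 ltr_pdivrMr // mulr2n mulrDr mulr1 ltrDl.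
pose T x : 'rV[R]_m := (x - Phi x *m B) + y *m B.
have TC x : C x -> C (T x).
  move=> Cx; have := Cx; rewrite !CE distrC (distrC a) => Cx'.
  have -> : T x - a = ((x - Phi x *m B) - (a - Phi a *m B)) + (y - Phi a) *m B.
    rewrite /T mulmxBl; move: (Phi x *m B) (Phi a *m B) (y *m B) => p q s.
    by apply/rowP => i; rewrite !mxE; ring.
  apply: le_trans (ler_normD _ _) _.
  have := lip _ _ (ballxx a r0) (Cb x Cx).
  move: Cx' yr; rewrite /r2; move: `|x - a| `|(y - Phi a) *m B| => u v Cx' yr H.
  apply: le_trans (lerD H (ltW yr)) _; lra.
have cT : is_contraction (mkfun TC).
  exists (2^-1)%:nng; split; first by rewrite /= invf_lt1 // ltr1n.
  move=> [u v] [/= Cu Cv]; rewrite /self_sub /=.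
  rewrite /T opprD addrACA subrr addr0.
  by apply: lip; exact: Cb.
have [||x Cx xE] := banach_fixed_point cT.
- exact: closed_ball_closed.
- by exists a; rewrite CE subrr normr0 ltW.
exists x; first exact: Cb.
have : (y - Phi x) *m B = 0.
  have /eqP : x = T x by exact: xE.
  rewrite -subr_eq0 /T => /eqP e.
  rewrite mulmxBl -[RHS]oppr0 -[X in _ = - X]e.
  by apply/rowP => i; rewrite !mxE; ring.
move/(congr1 (fun u => u *m invmx B)); rewrite mulmxK // mul0mx => /eqP.
by rewrite subr_eq0 => /eqP ->.
Qed.

(** With k = psi(y + h) - psi(y), differentiability of Phi reads h = k J + o(k),
  hence k = h J^-1 + o(k), and the Lipschitz bound turns o(k) into o(h). *)
Lemma inverse_differentiable m (Phi psi : 'rV[R]_m -> 'rV[R]_m) (y : 'rV[R]_m)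
    (K : R) : 0 < K ->
  (\near y, Phi (psi y) = y) ->
  (\forall h \near 0, `|psi (h + y) - psi y| <= K * `|h|) ->
  differentiable Phi (psi y) -> jacobian Phi (psi y) \in unitmx ->
  differentiable psi y /\
  forall v, 'D_v psi y = v *m invmx (jacobian Phi (psi y)).
Proof.
move=> K0 Phipsi lip dPhi uJ; set x := psi y.
pose L : {linear 'rV[R]_m -> 'rV[R]_m} := mulmxr (invmx (jacobian Phi x)).
have [K2 K20 HK2] := bounded_mulmx (invmx (jacobian Phi x)).
have [|dpsi dE] := @approx_differentiable R _ _ psi L y (@continuous_mulmxr _ _ _ _).
  move=> e e0; have e'0 : 0 < e / (K * K2) by rewrite divr_gt0 // mulr_gt0.
  have /nbhs_ballP [d /= d0 Hd] := differentiable_approx dPhi e'0.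
  have Phi0 : \forall h \near 0, Phi (psi (h + y)) = h + y.
    by move/nbhs0P : Phipsi; apply: filterS => h; rewrite addrC.
  near=> h.
  have Hh : `|psi (h + y) - psi y| <= K * `|h| by near: h.
  have Ph : Phi (psi (h + y)) = h + y by near: h.
  set k := psi (h + y) - psi y in Hh *.
  have kd : ball 0 d k.
    rewrite -ball_normE /= sub0r normrN; apply: le_lt_trans Hh _.
    rewrite mulrC -ltr_pdivlMr //; near: h.
    exact: (@norm_near0 'rV[R]_m _ (divr_gt0 d0 K0)).
  have := Hd _ kd; rewrite /= subrK Ph (nbhs_singleton Phipsi) addrK.
  rewrite -deriveE // deriveEjacobian // => H.
  rewrite /L /=.
  have -> : k - h *m invmx (jacobian Phi x) =
      - ((h - k *m jacobian Phi x) *m invmx (jacobian Phi x)).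
    by rewrite mulmxBl mulmxK // opprB.
  rewrite normrN; apply: le_trans (HK2 _) _.
  apply: (@le_trans _ _ (K2 * (e / (K * K2) * (K * `|h|)))).
    rewrite ler_pM2l //; apply: le_trans H _.
    by rewrite ler_pM2l.
  by rewrite le_eqVlt; apply/orP; left; apply/eqP; field; rewrite !gt_eqF.
by split=> // v; rewrite deriveE // dE.
Unshelve. all: by end_near. Qed.

(** The inverse is differentiable, of derivative v |-> v J^-1, where J is the
  Jacobian of Phi at psi(y).  Its smoothness follows by induction: if psi is C^k,
  so are the entries of J composed with psi, hence those of J^-1, so that psi is
  C^(k+1). *)
Theorem inverse_function m (Om : set 'rV[R]_m) (Phi : 'rV[R]_m -> 'rV[R]_m) a :
  open Om -> Om a -> smooth_on Om Phi -> (forall v, 'D_v Phi a = 0 -> v = 0) ->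
  exists (U V : set 'rV[R]_m) (psi : 'rV[R]_m -> 'rV[R]_m),
  [/\ open U, U a, U `<=` Om, open V & V (Phi a)] /\
  [/\ forall x y, U x -> U y -> Phi x = Phi y -> x = y,
      forall y, V y -> U (psi y) /\ Phi (psi y) = y & smooth_on V psi].
Proof.
move=> oOm Oma sPhi inja.
have [B [r r0 [uB rOm contr]]] := newton_contraction oOm Oma (sPhi 1) inja.
have dPhi x : ball a r x -> differentiable Phi x.
  by move=> /rOm; have [d _] := sPhi 1; exact: d.
have lip := newton_lipschitz dPhi contr.
have [KB KB0 HKB] := bounded_mulmx B.
have expand x y : ball a r x -> ball a r y ->
    `|y - x| <= 2 * KB * `|Phi y - Phi x|.
  move=> ax ay.
  have E : y - x = (y - Phi y *m B) - (x - Phi x *m B) + (Phi y - Phi x) *m B.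
    rewrite mulmxBl; move: (Phi y *m B) (Phi x *m B) => p q.
    by apply/rowP => i; rewrite !mxE; ring.
  have := ler_normD ((y - Phi y *m B) - (x - Phi x *m B)) ((Phi y - Phi x) *m B).
  rewrite -E; have := lip x y ax ay; have := HKB (Phi y - Phi x).
  rewrite -mulrA.
  move: `|y - x| `|Phi y - Phi x| `|_ *m B| `|_ - (_ - _)| => p q s t.
  move: (KB * q) => w H1 H2 H3; lra.
have uJ x : ball a r x -> jacobian Phi x \in unitmx.
  move=> ax; apply: jacobian_unit; first exact: dPhi.
  move=> v Dv; have := contr _ v ax; rewrite Dv mul0mx subr0 => H.
  by apply/eqP; rewrite -normr_le0; move: H; move: `|v| => p H; lra.
pose V := [set y : 'rV[R]_m | `|(y - Phi a) *m B| < r / 4].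
have oV : open V.
  have cV : continuous (fun y : 'rV[R]_m => `|(y - Phi a) *m B|).
    move=> y.
    pose f (z : 'rV[R]_m) : 'rV[R]_m := z - Phi a.
    have cf : {for y, continuous f} := differentiable_continuous
      (differentiableB (differentiable_id y) (differentiable_cst (Phi a) y)).
    have c2 := @continuous_comp _ _ _ f (fun u => u *m B) y cf
      (@continuous_mulmxr _ _ _ B (f y)).
    exact: (cvg_norm c2).
  have := open_comp (D := [set t : R | t < r / 4]) (fun y _ => cV y).
  by apply; exact: open_lt.
pose psi y := xget a (fun x => ball a r x /\ Phi x = y).
have psiP y : V y -> ball a r (psi y) /\ Phi (psi y) = y.
  move=> Vy; rewrite /psi; case: xgetP => [x -> //|].
  have [x ax Px] := newton_solution r0 uB lip Vy.
  by move=> /(_ x) [].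
have dpsi y : V y -> differentiable psi y /\
    forall v, 'D_v psi y = v *m invmx (jacobian Phi (psi y)).
  move=> Vy; have [by_ Py] := psiP y Vy.
  apply: (inverse_differentiable (K := 2 * KB)); first by rewrite mulr_gt0.
  - by apply: near_open oV Vy _ => z /psiP [].
  - have : \near y, V y by apply: near_open oV Vy _.
    move/nbhs0P; apply: filterS => h; rewrite addrC => Vh.
    have [bh Ph] := psiP _ Vh.
    by apply: le_trans (expand _ _ by_ bh) _; rewrite Ph Py addrK.
  - exact: dPhi.
  - exact: uJ.
exists (ball a r), V, psi; split; first split => //.
- exact: ball_open.
- exact: ballxx.
- by rewrite /V /= subrr mul0mx normr0 divr_gt0.
split=> // [x y ax ay E|].
  have := expand _ _ ax ay; rewrite E subrr normr0 mulr0 normr_le0 subr_eq0.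
  by move=> /eqP.
elim=> [|k IH]; first by move=> y /dpsi [d _]; exact: differentiable_continuous.
split=> [y /dpsi [] //|v].
have : Ck_on k V (fun y => v *m invmx (jacobian Phi (psi y))).
  apply: Ck_on_mulmx_inv => //.
    by move=> y /psiP [ay _]; exact: uJ.
  move=> i j.
  have : Ck_on k V (fun y => ('D_(delta_mx 0 i) Phi \o psi) y 0 j).
    apply: Ck_on_coord => //; apply: (Ck_on_comp (U' := Om)) => //.
      by move=> y /psiP [/rOm].
    by have [_] := sPhi k.+1; exact.
  apply: eq_Ck_on => // y; rewrite inE => /psiP [ay _] /=.
  by rewrite deriveEjacobian; [rewrite -rowE mxE|exact: dPhi].
by apply: eq_Ck_on => // y; rewrite inE => /dpsi [_ ->].
Qed.

End InverseFunction.

(** * Euclidean geometry of the unit sphere *)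

Lemma near_eq_continuous (T U : topologicalType) (f1 f2 : T -> U) (x : T) :
  (\forall y \near x, f1 y = f2 y) -> {for x, continuous f1} ->
  {for x, continuous f2}.
Proof.
move=> H; rewrite /prop_for /continuous_at -(nbhs_singleton H).
by apply: cvg_trans; exact: near_eq_cvg.
Qed.

Lemma continuous_id_at (T : topologicalType) (x : T) :
  {for x, continuous (@id T)}.
Proof. exact: cvg_id. Qed.

Section Sphere.
Context {R : realType} {m : nat}.
Implicit Types (x y z u v w : 'rV[R]_m).

Lemma dotC u v : dot u v = dot v u.
Proof. by apply: eq_bigr => i _; rewrite mulrC. Qed.

Lemma dotDl u v w : dot (u + v) w = dot u w + dot v w.
Proof. by rewrite -big_split; apply: eq_bigr => i _; rewrite mxE mulrDl. Qed.

Lemma dotZl (k : R) u v : dot (k *: u) v = k * dot u v.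
Proof. by rewrite mulr_sumr; apply: eq_bigr => i _; rewrite mxE mulrA. Qed.

Lemma dotDr u v w : dot u (v + w) = dot u v + dot u w.
Proof. by rewrite dotC dotDl !(dotC u). Qed.

Lemma dotZr (k : R) u v : dot u (k *: v) = k * dot u v.
Proof. by rewrite dotC dotZl (dotC u). Qed.

Lemma dotNl u v : dot (- u) v = - dot u v.
Proof. by rewrite -scaleN1r dotZl mulN1r. Qed.

Lemma dotNr u v : dot u (- v) = - dot u v.
Proof. by rewrite dotC dotNl dotC. Qed.

Lemma dot0l u : dot 0 u = 0.
Proof. by rewrite -(scale0r u) dotZl mul0r. Qed.

Lemma dot0r u : dot u 0 = 0.
Proof. by rewrite dotC dot0l. Qed.

Definition dotE := (dotDl, dotDr, dotZl, dotZr, dotNl, dotNr, dot0l, dot0r).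

Lemma dot_ge0 u : 0 <= dot u u.
Proof. by apply: sumr_ge0 => i _; rewrite -expr2 sqr_ge0. Qed.

Lemma dot_eq0 u : (dot u u == 0) = (u == 0).
Proof.
apply/eqP/eqP => [|->]; last by rewrite dot0l.
move=> H; apply/rowP => i; rewrite mxE; apply/eqP; rewrite -sqrf_eq0 expr2.
apply/eqP; apply: (psumr_eq0P _ H) => // j _.
by rewrite -expr2 sqr_ge0.
Qed.

Lemma dot_gt0 u : u != 0 -> 0 < dot u u.
Proof. by move=> u0; rewrite lt_neqAle eq_sym dot_eq0 u0 dot_ge0. Qed.

Lemma coord_sqr_le_dot u j : u 0 j ^+ 2 <= dot u u.
Proof.
rewrite /dot (bigD1 j) //= -expr2 lerDl.
by apply: sumr_ge0 => i _; rewrite -expr2 sqr_ge0.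
Qed.

Lemma usphereE x : usphere R m x = (dot x x = 1) :> Prop.
Proof.
rewrite /usphere /= /enorm; apply/propext; split=> [H|->]; last exact: sqrtr1.
by rewrite -(sqr_sqrtr (dot_ge0 x)) H expr1n.
Qed.

Lemma enorm_sqr u : enorm u ^+ 2 = dot u u.
Proof. by rewrite sqr_sqrtr // dot_ge0. Qed.

Lemma enorm_gt0 u : u != 0 -> 0 < enorm u.
Proof. by move=> u0; rewrite sqrtr_gt0 dot_gt0. Qed.

Lemma enorm1 u : dot u u = 1 -> enorm u = 1.
Proof. by rewrite /enorm => ->; rewrite sqrtr1. Qed.

Lemma dot1_neq0 x : dot x x = 1 -> x != 0.
Proof. by move=> x1; rewrite -dot_eq0 x1 oner_eq0. Qed.

Lemma dot_le1 x y : dot x x = 1 -> dot y y = 1 -> dot x y <= 1.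
Proof.
by move=> x1 y1; have := dot_ge0 (x - y); rewrite !dotE x1 y1 (dotC y); lra.
Qed.

Lemma dot_geN1 x y : dot x x = 1 -> dot y y = 1 -> -1 <= dot x y.
Proof.
by move=> x1 y1; have := dot_ge0 (x + y); rewrite !dotE x1 y1 (dotC y); lra.
Qed.

Lemma dot_eq1 x y : dot x x = 1 -> dot y y = 1 -> dot x y = 1 -> x = y.
Proof.
move=> x1 y1 xy; apply/eqP; rewrite -subr_eq0 -dot_eq0.
by rewrite !dotE x1 y1 (dotC y) xy; apply/eqP; ring.
Qed.

Lemma dot_eqN1 x y : dot x x = 1 -> dot y y = 1 -> dot x y = -1 -> x = - y.
Proof.
move=> x1 y1 xy; apply: dot_eq1 => //; rewrite !dotE ?y1 ?xy; ring.
Qed.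

(** A substitute for the triangle inequality between angles: for unit vectors
  1 - dot x z is half the square of |x - z|. *)
Lemma chord_triangle x y z : dot x x = 1 -> dot y y = 1 -> dot z z = 1 ->
  1 - dot x z <= 2 * ((1 - dot x y) + (1 - dot y z)).
Proof.
move=> x1 y1 z1; have := dot_ge0 (x + z - 2 *: y).
rewrite !dotE x1 y1 z1 (dotC z) (dotC y x) (dotC z y); lra.
Qed.

Lemma Cauchy_Schwarz u v : dot u v ^+ 2 <= dot u u * dot v v.
Proof.
have [->|v0] := eqVneq v 0; first by rewrite !dot0r expr0n mulr0.
have v1 := dot_gt0 v0.
have := dot_ge0 (dot v v *: u - dot u v *: v); rewrite !dotE (dotC v u).
move: v1; move: (dot u u) (dot v v) (dot u v) => a b c b0 H.
rewrite -subr_ge0 -(pmulr_rge0 _ b0).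
by move: H; congr (is_true (0 <= _)); ring.
Qed.

(** Functions on the sphere are handled as functions on the punctured space that
  factor through this radial projection: their continuity is then a matter of
  open sets of the ambient space. *)
Definition normalize u : 'rV[R]_m := (enorm u)^-1 *: u.

Lemma dot_normalize u : u != 0 -> dot (normalize u) (normalize u) = 1.
Proof.
move=> u0; rewrite !dotE -enorm_sqr; field.
by rewrite gt_eqF // enorm_gt0.
Qed.

Lemma normalize_unit u : dot u u = 1 -> normalize u = u.
Proof. by move=> u1; rewrite /normalize enorm1 // invr1 scale1r. Qed.

Lemma cvg_coord (T : topologicalType) (f : T -> 'rV[R]_m) (x : T) :
  {for x, continuous f} -> forall j, {for x, continuous (fun y : T => f y 0 j)}.
Proof.
move=> cf j; apply: (continuous_comp (g := fun u : 'rV[R]_m => u 0 j)) => //.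
exact: coord_continuous.
Qed.

Lemma continuous_dot (T : topologicalType) (f g : T -> 'rV[R]_m) (x : T) :
  {for x, continuous f} -> {for x, continuous g} ->
  {for x, continuous (fun y : T => dot (f y) (g y))}.
Proof.
move=> cf cg.
have : {for x, continuous (fun y : T => \sum_i f y 0 i * g y 0 i)}.
  apply: (@cvg_big) => //; first exact: add_continuous.
  by move=> i _; apply: cvgM; exact: cvg_coord.
by [].
Qed.

Lemma continuous_normalize (T : topologicalType) (f : T -> 'rV[R]_m) (x : T) :
  f x != 0 -> {for x, continuous f} ->
  {for x, continuous (fun y : T => normalize (f y))}.
Proof.
move=> fx0 cf; apply: cvgZ; last exact: cf.
apply: cvgV; first by rewrite gt_eqF // enorm_gt0.
exact: (continuous_comp (continuous_dot cf cf) (@sqrt_continuous R _)).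
Qed.

Lemma continuous_affine (T : topologicalType) (f : T -> 'rV[R]_m) (x : T) a
    (k : R) : {for x, continuous f} ->
  {for x, continuous (fun y : T => a + k *: f y)}.
Proof.
by move=> cf; apply: cvgD; [exact: cvg_cst|apply: cvgZl_tmp; exact: cf].
Qed.

Lemma dot_segment x y (t : R) : dot x x = 1 -> dot y y = 1 ->
  dot ((1 - t) *: x + t *: y) ((1 - t) *: x + t *: y) =
  1 - 2 * (t * (1 - t)) * (1 - dot x y).
Proof. by move=> x1 y1; rewrite !dotE x1 y1 (dotC y); ring. Qed.

(** The chord between unit vectors x and y comes closest to the origin at its
  midpoint. *)
Lemma segment_ge x y (t : R) : dot x x = 1 -> dot y y = 1 ->
  (1 + dot x y) / 2 <= dot ((1 - t) *: x + t *: y) ((1 - t) *: x + t *: y).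
Proof.
move=> x1 y1; rewrite dot_segment //.
have H := sqr_ge0 (1 - 2 * t); have := dot_le1 x1 y1.
rewrite -subr_ge0 => /(mulr_ge0 H); move: (dot x y) => a; nra.
Qed.

Lemma segment_neq0 x y (t : R) : dot x x = 1 -> dot y y = 1 -> -1 < dot x y ->
  (1 - t) *: x + t *: y != 0.
Proof.
move=> x1 y1 xy; rewrite -dot_eq0 gt_eqF //.
by apply: lt_le_trans (segment_ge t x1 y1); rewrite divr_gt0 // -ltrBlDl sub0r.
Qed.

Lemma continuous_segment x y : continuous (fun t : R => (1 - t) *: x + t *: y).
Proof.
move=> t; apply: cvgD; apply: cvgZr_tmp; last exact: cvg_id.
by apply: cvgB; [exact: cvg_cst|exact: cvg_id].
Qed.

(** Spherical caps of radius at most a right angle are geodesically star-shaped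
  about their centre. *)
Lemma dot_normalized_segment x y (t : R) : dot x x = 1 -> dot y y = 1 ->
  0 <= dot x y -> 0 <= t <= 1 ->
  dot x y <= dot x (normalize ((1 - t) *: x + t *: y)).
Proof.
move=> x1 y1 xy /andP[t0 t1]; set u := _ + _.
have u0 : u != 0 by apply: segment_neq0 => //; lra.
rewrite /normalize dotZr mulrC ler_pdivlMr ?enorm_gt0 //.
have u1 : enorm u <= 1.
  rewrite -sqrtr1 /enorm ler_wsqrtr // dot_segment //.
  have : 0 <= t * (1 - t) * (1 - dot x y).
    by rewrite !mulr_ge0 ?subr_ge0 // dot_le1.
  lra.
apply: (@le_trans _ _ (dot x y)); first by rewrite ler_piMr.
have : 0 <= (1 - t) * (1 - dot x y) by rewrite mulr_ge0 ?subr_ge0 // dot_le1.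
rewrite /u !dotE x1; lra.
Qed.

Lemma dot_polarization x y :
  dot x y = (enorm x ^+ 2 + enorm y ^+ 2 - dot (x - y) (x - y)) / 2.
Proof. by rewrite !enorm_sqr !dotE (dotC y x); lra. Qed.

(** The chord from x to y stays at a distance at least sqrt (d / 2) from the origin
  (segment_ge), so the radial projection expands the steps along it by a bounded
  factor. *)
Lemma dot_normalized_step x y (d t t' : R) : 0 < d -> dot x x = 1 ->
  dot y y = 1 -> -1 + d < dot x y ->
  1 - 4 * (t - t') ^+ 2 / d <=
  dot (normalize ((1 - t) *: x + t *: y)) (normalize ((1 - t') *: x + t' *: y)).
Proof.
move=> d0 x1 y1 xy.
set a := (1 - t) *: x + t *: y; set b := (1 - t') *: x + t' *: y.
have a0 : a != 0 by apply: segment_neq0 => //; lra.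
have b0 : b != 0 by apply: segment_neq0 => //; lra.
have Ha : d / 2 <= enorm a ^+ 2.
  by rewrite enorm_sqr; apply: le_trans (segment_ge t x1 y1); lra.
have Hb : d / 2 <= enorm b ^+ 2.
  by rewrite enorm_sqr; apply: le_trans (segment_ge t' x1 y1); lra.
have hd2 : 0 <= d / 2 by lra.
have pa := enorm_gt0 a0; have pb := enorm_gt0 b0.
have Hab : d / 2 <= enorm a * enorm b.
  have pab : 0 <= enorm a * enorm b by rewrite ltW // mulr_gt0.
  rewrite -(ler_pXn2r (n := 2)) ?nnegrE // [leRHS]exprMn expr2.
  exact: ler_pM.
have E : dot (a - b) (a - b) = (t - t') ^+ 2 * (2 - 2 * dot x y).
  by rewrite /a /b !dotE x1 y1 (dotC y); ring.
have Hd : dot a b = (enorm a ^+ 2 + enorm b ^+ 2 - dot (a - b) (a - b)) / 2.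
  exact: dot_polarization.
have Hd2 : enorm a * enorm b - 2 * (t - t') ^+ 2 <= dot a b.
  have H1 : dot (a - b) (a - b) <= (t - t') ^+ 2 * 4.
    by rewrite E ler_wpM2l ?sqr_ge0 //; have := dot_geN1 x1 y1; lra.
  have H2 : 2 * (enorm a * enorm b) <= enorm a ^+ 2 + enorm b ^+ 2.
    by have := sqr_ge0 (enorm a - enorm b); rewrite sqrrB; lra.
  rewrite Hd; lra.
rewrite /normalize dotZl dotZr [leRHS]mulrA -invfM [leRHS]mulrC ler_pdivlMr.
  2: by rewrite mulr_gt0.
apply: le_trans Hd2; rewrite mulrBl mul1r lerD2l lerN2.
have H : d / 2 * (4 * (t - t') ^+ 2 / d) = 2 * (t - t') ^+ 2.
  by field; rewrite gt_eqF.
rewrite -H mulrC ler_wpM2l // mulr_ge0 ?invr_ge0 ?(ltW d0) //.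
by rewrite mulr_ge0 // sqr_ge0.
Qed.

Lemma orthogonal_unit x y : (2 < m)%N ->
  exists w, [/\ dot w w = 1, dot w x = 0 & dot w y = 0].
Proof.
move=> m2; pose A : 'M[R]_(m, 1 + 1) := row_mx x^T y^T.
have /rowV0Pn [w /sub_kermxP wA w0] : kermx A != 0.
  rewrite kermx_eq0 /row_free neq_ltn; apply/orP; left.
  exact: leq_ltn_trans (rank_leq_col _) m2.
move: wA; rewrite /A mul_mx_row -row_mx0 => /eq_row_mx[wx wy].
have dE v : dot w v = (w *m v^T) 0 0.
  by rewrite mxE; apply: eq_bigr => i _; rewrite mxE.
exists (normalize w); rewrite dot_normalize // /normalize !dotZl !dE.
by rewrite wx wy !mxE mulr0.
Qed.

(** For unit vectors |x - y|^2 = 2 (1 - dot x y), and the sup norm is at most the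
  Euclidean norm. *)
Lemma open_contains_cap (V : set 'rV[R]_m) x : open V -> V x -> dot x x = 1 ->
  exists2 e : R, 0 < e & forall y, dot y y = 1 -> 1 - e < dot x y -> V y.
Proof.
move=> oV Vx x1.
have /nbhs_ballP [d /= d0 dV] : nbhs x V by exact: open_nbhs_nbhs.
exists (d ^+ 2 / 4); first by rewrite divr_gt0 // exprn_gt0.
move=> y y1 xy; apply: dV; split=> // i j; rewrite ord1 {i}.
rewrite -ball_normE /=; rewrite -(ltr_pXn2r (n := 2)) ?nnegrE ?(ltW d0) //.
have -> : x 0 j - y 0 j = (x - y) 0 j by rewrite !mxE.
rewrite real_normK ?num_real //; apply: le_lt_trans (coord_sqr_le_dot _ _) _.
rewrite !dotE x1 y1 (dotC y); have := sqr_ge0 d; lra.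
Qed.

(** The cone over the complement of a cap centered at - x. *)
Definition away x (d : R) := [set y | y != 0 /\ -1 + d < dot x (normalize y)].

Lemma open_away x d : open (away x d).
Proof.
rewrite openE => y [y0 xy]; rewrite /interior /=.
have cid : {for y, continuous (@id 'rV[R]_m)} by exact: continuous_id_at.
have H1 : \forall z \near y, 0 < dot z z.
  by apply: (cvgr_gt _ (continuous_dot cid cid)); exact: dot_gt0.
have H2 : \forall z \near y, -1 + d < dot x (normalize z).
  by apply: (cvgr_gt _ (continuous_dot (@cst_continuous _ _ x y)
    (continuous_normalize y0 cid))).
apply: filterS2 H1 H2 => z z0 xz; split=> //.
by rewrite -dot_eq0 gt_eqF.
Qed.

(** The point of height a over the hyperplane orthogonal to x on the meridian in
  the direction w. *)
Definition meridian x a w : 'rV[R]_m := a *: x + Num.sqrt (1 - a ^+ 2) *: w.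

Lemma dot_meridian x (a : R) w : dot x x = 1 -> dot w w = 1 -> dot w x = 0 ->
  -1 <= a <= 1 ->
  dot (meridian x a w) (meridian x a w) = 1 /\ dot x (meridian x a w) = a.
Proof.
move=> x1 w1 wx /andP[a0 a1]; rewrite /meridian !dotE x1 w1 (dotC x w) wx.
have a2 : 0 <= 1 - a ^+ 2.
  have -> : 1 - a ^+ 2 = (1 - a) * (1 + a) by ring.
  by rewrite mulr_ge0 //; lra.
split; last by ring.
have := sqr_sqrtr a2; move: (Num.sqrt _) => r; rewrite expr2 => rr.
by rewrite !mulr0 !mulr1 addr0 add0r rr; ring.
Qed.

(** Every point of the sphere lies on a meridian; at the poles the direction is
  arbitrary, which is where a vector orthogonal to x is needed. *)
Lemma meridianP x y : (2 < m)%N -> dot x x = 1 -> dot y y = 1 ->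
  exists u, [/\ dot u u = 1, dot u x = 0 & y = meridian x (dot x y) u].
Proof.
move=> m2 x1 y1; set a := dot x y; pose v := y - a *: x.
have vx : dot v x = 0 by rewrite /v !dotE x1 (dotC y) -/a; ring.
have vv : dot v v = 1 - a ^+ 2 by rewrite /v !dotE x1 y1 (dotC y) -/a; ring.
rewrite /meridian -vv; have [v0|v0] := eqVneq v 0.
  have [u [u1 ux _]] := orthogonal_unit x x m2; exists u; split=> //.
  rewrite v0 dot0l sqrtr0 scale0r addr0; apply/eqP.
  by rewrite -subr_eq0 -/v v0.
exists (normalize v); split; first exact: dot_normalize.
  by rewrite /normalize dotZl vx mulr0.
rewrite -/(enorm v) /normalize scalerA mulfV ?scale1r ?subrKC //.
by rewrite gt_eqF // enorm_gt0.
Qed.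

Lemma continuous_meridian (T : topologicalType) x (a : T -> R) (w : T -> 'rV[R]_m)
    (t : T) : {for t, continuous a} -> {for t, continuous w} ->
  {for t, continuous (fun s : T => meridian x (a s) (w s))}.
Proof.
move=> ca cw; apply: cvgD; first by apply: cvgZr_tmp; exact: ca.
apply: cvgZ; last exact: cw.
have c1 : {for t, continuous (fun s : T => 1 - a s ^+ 2)}.
  by apply: cvgB; [exact: cvg_cst|rewrite !expr2; apply: cvgM; exact: ca].
exact: (continuous_comp c1 (@sqrt_continuous R _)).
Qed.

Lemma lt_segment (a a' t : R) : 0 <= t <= 1 ->
  forall L, L < a -> L < a' -> L < (1 - t) * a + t * a'.
Proof.
move=> /andP[t0 t1] L La La'; have t1' : 0 <= 1 - t by rewrite subr_ge0.
have [aa'|/ltW aa'] := leP a a'; rewrite -subr_ge0 in aa'.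
  by have := mulr_ge0 t0 aa'; lra.
by have := mulr_ge0 t1' aa'; lra.
Qed.

End Sphere.

(** * Local homeomorphisms onto the sphere are bijective *)

(** The coincidence set is closed because M is Hausdorff and open because f is
  locally injective. *)
Lemma unique_lift (X M : topologicalType) (T : Type) (f : M -> T) (A : set X)
    (a b : X -> M) (x0 : X) :
  hausdorff_space M ->
  (forall p : M, exists W : set M, [/\ open W, W p &
    forall q q', W q -> W q' -> f q = f q' -> q = q']) ->
  connected A ->
  (forall x, A x -> {for x, continuous a}) ->
  (forall x, A x -> {for x, continuous b}) ->
  (forall x, A x -> f (a x) = f (b x)) ->
  A x0 -> a x0 = b x0 -> forall x, A x -> a x = b x.
Proof.
move=> hM inj cA ca cb fab Ax0 ab0 x Ax.
pose B := A `&` [set x | a x = b x].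
suff BA : B = A by have : B x by [rewrite BA]; case.
apply: cA; first by exists x0.
  exists [set y | A y -> a y = b y]°; first exact: open_interior.
  apply/seteqP; split=> y; last by move=> [Ay /interior_subset /(_ Ay)].
  move=> [Ay aby]; split=> //.
  have [W [oW Oa Oinj]] := inj (a y).
  have Hna : \forall z \near y, W (a z).
    by apply: (ca y Ay); exact: open_nbhs_nbhs.
  have Hnb : \forall z \near y, W (b z).
    by apply: (cb y Ay); apply: open_nbhs_nbhs; rewrite -aby.
  rewrite /interior /=; near=> z => Az; apply: Oinj; last exact: fab.
    by near: z.
  by near: z.
exists (~` [set y | A y -> a y <> b y]°).
  by apply: open_closedC; exact: open_interior.
apply/seteqP; split=> y.
  by move=> [Ay aby]; split=> // /interior_subset /(_ Ay).
move=> [Ay nab]; split=> //=; apply: contrapT => ab; apply: nab.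
move: hM; rewrite open_hausdorff => /(_ (a y) (b y)).
move=> /(_ ltac:(exact/eqP)) [[U V] /= [+ +]] [oU oV /eqP UV].
rewrite !inE => Ua Vb.
have Hna : \forall z \near y, U (a z).
  by apply: (ca y Ay); exact: open_nbhs_nbhs.
have Hnb : \forall z \near y, V (b z).
  by apply: (cb y Ay); exact: open_nbhs_nbhs.
rewrite /interior /=; near=> z => Az abz.
have : (U `&` V) (a z) by split; [near: z|rewrite abz; near: z].
by rewrite UV.
Unshelve. all: by end_near. Qed.

Section Covering.
Context {R : realType} {m : nat} {M : topologicalType}.
Local Notation E := ('rV[R]_m).
Implicit Types (p q : M) (x y z u v w : E).
Variable f : M -> E.

(** The inverse h of f near p is only an inverse on the sphere, but it is
  continuous on an open set of the ambient space, so that neither subspace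
  topologies nor charts of the sphere are needed. *)
Definition local_inverse p (W : set M) (V : set E) (h : E -> M) :=
  [/\ [/\ open W, W p & forall q q', W q -> W q' -> f q = f q' -> q = q'],
      open V /\ V (f p),
      forall y, V y -> dot y y = 1 -> W (h y) /\ f (h y) = y &
      forall y, V y -> {for y, continuous h}].

Hypothesis M_compact : compact [set: M].
Hypothesis M_connected : connected [set: M].
Hypothesis M_hausdorff : hausdorff_space M.
Hypothesis f_unit : forall p, dot (f p) (f p) = 1.
Hypothesis f_continuous : continuous f.
Hypothesis f_local : forall p, exists W V h, local_inverse p W V h.

Let f_inj p : exists W : set M, [/\ open W, W p &
    forall q q', W q -> W q' -> f q = f q' -> q = q'].
Proof. by have [W [V [h [[]]]]] := f_local p; exists W. Qed.

Let chart_of p : {t : set M * set E * (E -> M) |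
  local_inverse p t.1.1 t.1.2 t.2}.
Proof.
apply: cid; have [W [V [h H]]] := f_local p.
by exists (W, V, h).
Qed.
Let W p := (sval (chart_of p)).1.1.
Let V p := (sval (chart_of p)).1.2.
Let h p := (sval (chart_of p)).2.
Let locP p : local_inverse p (W p) (V p) (h p).
Proof. exact: svalP (chart_of p). Qed.

Let valid_at (c : R) p q :=
  W p q /\ forall y, dot y y = 1 -> c < dot (f q) y -> V p y.

(** A Lebesgue number argument: the condition holds for q near p and c near 1, so
  compactness makes c uniform.  Asking for all points near q gives the
  continuity in uniform_section. *)
Let uniform_cap : exists2 c : R, 0 <= c < 1 &
  forall q, exists p, \near q, valid_at c p q.
Proof.
have /compact_near_coveringP /(_ _ _ (fun c q => exists p, \near q, valid_at c p q)) :=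
  M_compact.
move=> /(_ ((1 : R)^'-) _) H.
have : \forall c \near (1 : R)^'-, [set: M] `<=`
    (fun q => exists p, \near q, valid_at c p q).
  apply: H => p _.
  have [[oW Op _] [oV Vp] _ _] := locP p.
  have [e e0 He] := open_contains_cap oV Vp (f_unit p).
  pose W' := W p `&` [set q | 1 - e / 4 < dot (f p) (f q)].
  have oW' : open W'.
    apply: openI => //.
    have cd : continuous (fun q => dot (f p) (f q)).
      by move=> q; apply: continuous_dot; [exact: cst_continuous|exact: f_continuous].
    have := open_comp (D := [set t : R | 1 - e / 4 < t]) (fun q _ => cd q).
    by apply; exact: open_gt.
  have W'p : W' p by split=> //=; rewrite f_unit; lra.
  exists (W', [set c : R | 1 - e / 4 < c]) => /=.
    split; first exact: open_nbhs_nbhs.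
    by apply: nbhs_left_gt; lra.
  move=> [q c] /= [W'q ec]; exists p.
  have : \near q, W' q by exact: open_nbhs_nbhs.
  apply: filterS => q' [Oq' qq']; split=> // y y1 cy.
  apply: He => //; have := chord_triangle (f_unit p) (f_unit q') y1.
  move: qq' => /=; lra.
move=> Hc.
have Hc0 : \forall c \near (1 : R)^'-, 0 <= c by exact: nbhs_left_ge.
have Hc1 : \forall c \near (1 : R)^'-, c < 1 by exact: nbhs_left_lt.
have [c [[c0 c1] cP]] := filter_ex (filterI (filterI Hc0 Hc1) Hc).
by exists c => [|q]; [exact/andP|exact: cP q I].
Qed.

Let h_center c p q : 0 <= c < 1 -> valid_at c p q -> h p (f q) = q.
Proof.
move=> /andP[c0 c1] [Wq cV]; have [[oW Wp Winj] _ hP _] := locP p.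
have Vq : V p (f q) by apply: cV; rewrite f_unit.
by have [Wh fh] := hP _ Vq (f_unit q); apply: Winj.
Qed.

(** Two local inverses defined on the cap about f(q) agree there, by uniqueness of
  lifts along the geodesics issued from f(q). *)
Let h_indep c p p' q y : 0 <= c < 1 -> valid_at c p q -> valid_at c p' q ->
  dot y y = 1 -> c < dot (f q) y -> h p y = h p' y.
Proof.
move=> c01 gp gp' y1 qy; have /andP[c0 c1] := c01.
pose g (t : R) := normalize ((1 - t) *: f q + t *: y).
have qy0 : 0 <= dot (f q) y by lra.
have gN t : (1 - t) *: f q + t *: y != 0.
  by apply: segment_neq0 => //; lra.
have g1 t : dot (g t) (g t) = 1 by exact: dot_normalize.
have gc (t : R) : {for t, continuous g}.
  by apply: continuous_normalize => //; exact: continuous_segment.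
have gcap t : `[0, 1]%classic t -> c < dot (f q) (g t).
  rewrite /= in_itv /= => t01; apply: lt_le_trans qy _.
  exact: dot_normalized_segment.
have gE0 : g 0 = f q by rewrite /g subr0 scale1r scale0r addr0 normalize_unit.
have gE1 : g 1 = y by rewrite /g subrr scale1r scale0r add0r normalize_unit.
have lift p0 : valid_at c p0 q -> forall t, `[0, 1]%classic t ->
    {for t, continuous (h p0 \o g)} /\ f (h p0 (g t)) = g t.
  move=> [_ cV] t /gcap gt; have [_ _ hP hc] := locP p0.
  have Vg : V p0 (g t) by apply: cV.
  split; last by have [] := hP _ Vg (g1 t).
  by apply: continuous_comp; [exact: gc|exact: hc].
have := @unique_lift R M E f `[0, 1]%classic (h p \o g) (h p' \o g) 0
  M_hausdorff f_inj (@segment_connected R 0 1).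
move=> /(_ (fun t H => (lift p gp t H).1) (fun t H => (lift p' gp' t H).1)).
have E1 t : `[0, 1]%classic t -> f ((h p \o g) t) = f ((h p' \o g) t).
  by move=> H /=; rewrite (lift p gp t H).2 (lift p' gp' t H).2.
move=> /(_ E1); rewrite /= gE0 !(h_center c01) // => /(_ _ erefl 1).
by rewrite gE1; apply; rewrite in_itv /= ?lexx ?ler01.
Qed.

(** Selects at each q a local inverse that remains valid around q.  The selection is
  arbitrary, but any two valid choices give the same section, which makes the
  result continuous in q as well. *)
Lemma uniform_section : exists2 c : R, 0 <= c < 1 & exists sigma : M -> E -> M,
  [/\ forall q y, dot y y = 1 -> c < dot (f q) y -> f (sigma q y) = y,
      forall q, sigma q (f q) = q &
      forall (X : topologicalType) (u : X -> M) (w : X -> E) (x : X),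
        {for x, continuous u} -> {for x, continuous w} ->
        (\forall z \near x, dot (w z) (w z) = 1) ->
        c < dot (f (u x)) (w x) ->
        {for x, continuous (fun z : X => sigma (u z) (w z))}].
Proof.
have [c c01 /choice [pc Hpc]] := uniform_cap; exists c => //.
have gpc q : valid_at c (pc q) q := nbhs_singleton (Hpc q).
exists (fun q y => h (pc q) y); split.
- move=> q y y1 qy; have [_ cV] := gpc q; have [_ _ hP _] := locP (pc q).
  by have [] := hP y (cV y y1 qy) y1.
- by move=> q; exact: h_center c01 (gpc q).
move=> X u w x cu cw w1 qw.
have [_ _ _ hc] := locP (pc (u x)).
have wx1 : dot (w x) (w x) = 1 := nbhs_singleton w1.
have Vw : V (pc (u x)) (w x) by have [_ cV] := gpc (u x); exact: cV.
have c1 : {for x, continuous (fun z : X => h (pc (u x)) (w z))}.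
  exact: (@continuous_comp _ _ _ w (h (pc (u x))) x cw (hc _ Vw)).
have cd : {for x, continuous (fun z : X => dot (f (u z)) (w z))}.
  apply: continuous_dot => //; apply: (@continuous_comp _ _ _ u f) => //.
  exact: f_continuous.
have Hd : \forall z \near x, c < dot (f (u z)) (w z).
  exact: (cvgr_gt _ cd _ qw).
have Hg : \forall z \near x, valid_at c (pc (u x)) (u z) by exact: cu (Hpc (u x)).
have Heq : \forall z \near x, h (pc (u x)) (w z) = h (pc (u z)) (w z).
  near=> z; apply: (@h_indep c _ _ (u z)) => //.
  - by near: z.
  - by near: z.
  - by near: z.
apply: cvg_trans c1; exact: near_eq_cvg.
Unshelve. all: by end_near. Qed.

(** The section through p over the complement of a cap about - f(p) is obtained by
  composing K short lifts: the k-th one moves the lift of y along the projected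
  chord from f(p) to y, from time (k-1)/K to time k/K.  All y are lifted at once,
  so continuity in y is inherited from sigma. *)
Lemma section_away p (d : R) : 0 < d -> exists s : E -> M,
  s (f p) = p /\ forall y, away (f p) d y ->
    {for y, continuous s} /\ f (s y) = normalize y.
Proof.
move=> d0; have [c /andP[c0 c1] [sigma [sigma_f sigma_id sigma_c]]] := uniform_section.
pose K := (Num.Def.archi_bound (4 / (d * (1 - c)))).+1.
have K0 : 0 < K%:R :> R by rewrite ltr0n.
have KP : 4 * K%:R^-1 ^+ 2 / d < 1 - c :> R.
  have dc0 : 0 < d * (1 - c) by rewrite mulr_gt0 // subr_gt0.
  have H0 : 0 <= 4 / (d * (1 - c)) by rewrite divr_ge0 // ltW.
  have : 4 / (d * (1 - c)) < K%:R.
    by apply: lt_le_trans (archi_boundP H0) _; rewrite ler_nat leqnSn.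
  rewrite ltr_pdivrMr // => H.
  have K1 : K%:R^-1 <= 1 :> R by rewrite invf_le1 // ler1n.
  have Ki : 0 < K%:R^-1 :> R by rewrite invr_gt0.
  rewrite ltr_pdivrMr //; apply: (@le_lt_trans _ _ (4 * K%:R^-1)).
    by rewrite expr2 ler_pM2l // ler_piMl // ltW.
  by rewrite ltr_pdivrMr // mulrC (mulrC (1 - c)).
pose tt k : R := k%:R * K%:R^-1.
pose chord k y := normalize ((1 - tt k) *: f p + tt k *: normalize y).
pose s := fix s k y := if k is k'.+1 then sigma (s k' y) (chord k y) else p.
have awayE y : away (f p) d y -> [/\ y != 0, dot (normalize y) (normalize y) = 1 &
    -1 + d < dot (f p) (normalize y)].
  by move=> [y0 H]; split=> //; exact: dot_normalize.
have chord0 k y : away (f p) d y ->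
    (1 - tt k) *: f p + tt k *: normalize y != 0.
  by move=> /awayE [y0 y1 H]; apply: segment_neq0 => //; lra.
have chord1 k y : away (f p) d y -> dot (chord k y) (chord k y) = 1.
  by move=> /(chord0 k) H; exact: dot_normalize.
have chord_c k y : away (f p) d y -> {for y, continuous (chord k)}.
  move=> ay; apply: continuous_normalize; first exact: chord0.
  have [y0 _ _] := awayE y ay.
  have cN := @continuous_normalize R m E id y y0 (@continuous_id_at E y).
  exact: (@continuous_affine R m E normalize y ((1 - tt k) *: f p) (tt k) cN).
have sP k y : away (f p) d y -> {for y, continuous (s k)} /\ f (s k y) = chord k y.
  move=> ay; elim: k => [|k [IHc IH]].
    split; first exact: cst_continuous.
    by rewrite /chord /tt mul0r subr0 scale1r scale0r addr0 normalize_unit.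
  have [y0 y1 H] := awayE y ay.
  have step : c < dot (f (s k y)) (chord k.+1 y).
    rewrite IH; apply: lt_le_trans (dot_normalized_step _ _ d0 (f_unit p) y1 H).
    have -> : tt k - tt k.+1 = - K%:R^-1.
      by rewrite /tt -mulrBl -addn1 natrD opprD addNKr mulN1r.
    by rewrite sqrrN; lra.
  split; last by apply: sigma_f => //; exact: chord1.
  refine (sigma_c E (s k) (chord k.+1) y IHc (chord_c k.+1 y ay) _ step).
  have := open_nbhs_nbhs (conj (@open_away _ _ (f p) d) ay).
  by apply: filterS => z /(chord1 k.+1).
exists (s K); split=> [|y ay].
  elim: (K) => //= k ->.
  rewrite /chord (normalize_unit (f_unit p)) -scalerDl subrK scale1r.
  by rewrite (normalize_unit (f_unit p)) sigma_id.
have [? ->] := sP K y ay; split=> //; rewrite /chord /tt mulfV ?gt_eqF //.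
have [y0 y1 H] := awayE y ay.
by rewrite subrr scale0r add0r scale1r normalize_unit.
Qed.

(** A section over the complement of a small cap about -f(p) extends over the cap,
  because the annulus where both the section and its candidate extension are
  defined is connected, the sphere being of dimension m - 1 >= 2.  The resulting
  global section g is inverse to f since g o f and the identity are two lifts of f
  that coincide at p. *)
Theorem local_homeo_sphere_bijective (p : M) : (2 < m)%N ->
  exists g : E -> M,
    (forall q, g (f q) = q) /\ (forall y, dot y y = 1 -> f (g y) = y).
Proof.
move=> m2.
have [c /andP[c0 c1] [sigma [sigma_f sigma_id sigma_c]]] := uniform_section.
(* With this b, chord_triangle puts the whole cap dot y0 y < -1 + b in the domain of
  the local section through any point over that cap. *)
pose b := (1 - c) / 8; pose d := b / 2.
have b0 : 0 < b by rewrite divr_gt0 // subr_gt0.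
have b1 : b <= 8^-1 by rewrite /b; lra.
have d0 : 0 < d by rewrite divr_gt0.
have [s [s_p sP]] := section_away p d0.
set y0 := f p in s_p sP; have y01 : dot y0 y0 = 1 := f_unit p.
have unit_away y : dot y y = 1 -> -1 + d < dot y0 y -> away y0 d y.
  by move=> y1 ?; split; [exact: dot1_neq0|rewrite normalize_unit].
(* The annulus around - y0 where both sections are defined. *)
pose band (a : R) := -1 + d < a < -1 + b.
pose a0 : R := -1 + b * 3 / 4.
have band0 : band a0 by apply/andP; rewrite /a0 /d; split; lra.
have bandP a : band a -> -1 <= a <= 1.
  by move=> /andP[? ?]; apply/andP; split; lra.
have [w0 [w01 w0y _]] := orthogonal_unit y0 y0 m2.
have [w1 [w11 w1y w10]] := orthogonal_unit y0 w0 m2.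
pose z := meridian y0 a0 w0.
have [z1 z0] : dot z z = 1 /\ dot y0 z = a0 by exact: dot_meridian (bandP _ band0).
have az : away y0 d z by apply: unit_away => //; rewrite z0; case/andP: band0.
pose q := s z.
have fq : f q = z by have [_ ->] := sP z az; rewrite normalize_unit.
have near_q y : dot y y = 1 -> dot y0 y < -1 + b -> c < dot (f q) y.
  move=> y1 y0b; rewrite fq.
  have Ny01 : dot (- y0) (- y0) = 1 by rewrite !dotE y01; ring.
  have := chord_triangle z1 Ny01 y1.
  by rewrite dotNr dotNl (dotC z y0) z0 /a0; move: y0b; rewrite /b; lra.
pose s1 y := s (normalize y); pose s2 y := sigma q (normalize y).
have s1P y : y != 0 -> -1 + d < dot y0 (normalize y) ->
    {for y, continuous s1} /\ f (s1 y) = normalize y.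
  move=> yn0 yd; have yN := dot_normalize yn0.
  have [sc fs] := sP _ (unit_away _ yN yd); split; last by rewrite fs normalize_unit.
  have cN := @continuous_normalize R m E id y yn0 (@continuous_id_at E y).
  exact: (@continuous_comp _ _ _ normalize s y cN sc).
have s2P y : y != 0 -> dot y0 (normalize y) < -1 + b ->
    {for y, continuous s2} /\ f (s2 y) = normalize y.
  move=> yn0 yb; have yN := dot_normalize yn0.
  have cy := near_q _ yN yb; split; last exact: sigma_f.
  have cN := @continuous_normalize R m E id y yn0 (@continuous_id_at E y).
  refine (sigma_c E (fun=> q) normalize y (@cst_continuous _ _ q y) cN _ cy).
  have cid := @continuous_id_at E y.
  have H : \forall z \near y, 0 < dot z z.
    by apply: (cvgr_gt _ (continuous_dot cid cid)); exact: dot_gt0.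
  apply: filterS H => x xx; apply: dot_normalize.
  by rewrite -dot_eq0 gt_eqF.
(* A path in the annulus between two meridian directions, as long as they are not
  opposite. *)
have agree_path (a a' : R) w u : band a -> band a' -> dot w w = 1 -> dot w y0 = 0 ->
    dot u u = 1 -> dot u y0 = 0 -> -1 < dot w u ->
    s1 (meridian y0 a w) = s2 (meridian y0 a w) ->
    s1 (meridian y0 a' u) = s2 (meridian y0 a' u).
  move=> ba ba' w_1 wy u1 uy wu agr.
  pose dir (t : R) := normalize ((1 - t) *: w + t *: u).
  pose k (t : R) : R := (1 - t) * a + t * a'.
  pose g t := meridian y0 (k t) (dir t).
  have h1 t : dot (dir t) (dir t) = 1 by apply: dot_normalize; exact: segment_neq0.
  have hy t : dot (dir t) y0 = 0 by rewrite /dir /normalize !dotE wy uy !mulr0 addr0 mulr0.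
  have kb t : 0 <= t <= 1 -> band (k t).
    move=> t01; move: ba ba' => /andP[La aU] /andP[La' a'U].
    have H1 := lt_segment t01 La La'.
    rewrite -ltrN2 in aU; rewrite -ltrN2 in a'U.
    have H2 := lt_segment t01 aU a'U.
    by apply/andP; split; rewrite /k; lra.
  have gP t : 0 <= t <= 1 -> dot (g t) (g t) = 1 /\ dot y0 (g t) = k t.
    by move=> /kb /bandP kt; exact: dot_meridian.
  have cg (t : R) : {for t, continuous g}.
    apply: continuous_meridian.
      apply: cvgD; apply: cvgM; try exact: cvg_cst; try exact: cvg_id.
      by apply: cvgB; [exact: cvg_cst|exact: cvg_id].
    apply: continuous_normalize; first exact: segment_neq0.
    exact: continuous_segment.
  have lift t : `[0, 1]%classic t ->
      [/\ {for t, continuous (s1 \o g)}, {for t, continuous (s2 \o g)} &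
          f (s1 (g t)) = f (s2 (g t))].
    rewrite /= in_itv /= => t01; have [g1 gy] := gP t t01.
    have gn0 := dot1_neq0 g1; have /andP[kd kb'] := kb t t01.
    have [c1' f1] := s1P (g t) gn0 ltac:(by rewrite normalize_unit // gy).
    have [c2' f2] := s2P (g t) gn0 ltac:(by rewrite normalize_unit // gy).
    split; last by rewrite f1 f2.
      exact: (@continuous_comp _ _ _ g s1 t (cg t) c1').
    exact: (@continuous_comp _ _ _ g s2 t (cg t) c2').
  have gE0 : g 0 = meridian y0 a w.
    rewrite /g /k /dir subr0 scale1r scale0r addr0 (normalize_unit w_1).
    by rewrite mul1r mul0r addr0.
  have gE1 : g 1 = meridian y0 a' u.
    rewrite /g /k /dir subrr scale1r scale0r add0r (normalize_unit u1).
    by rewrite mul1r mul0r add0r.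
  have L1 t (H : `[0, 1]%classic t) : {for t, continuous (s1 \o g)} by case: (lift t H).
  have L2 t (H : `[0, 1]%classic t) : {for t, continuous (s2 \o g)} by case: (lift t H).
  have L3 t (H : `[0, 1]%classic t) : f ((s1 \o g) t) = f ((s2 \o g) t).
    by case: (lift t H).
  have := @unique_lift R M E f `[0, 1]%classic (s1 \o g) (s2 \o g) 0
    M_hausdorff f_inj (@segment_connected R 0 1) L1 L2 L3.
  rewrite /= gE0 => /(_ _ agr 1); rewrite gE1.
  by apply; rewrite in_itv /= ?lexx ?ler01.
have agree_z : s1 (meridian y0 a0 w0) = s2 (meridian y0 a0 w0).
  by rewrite -/z /s1 /s2 (normalize_unit z1) -{2}fq sigma_id.
have agree y : dot y y = 1 -> band (dot y0 y) -> s1 y = s2 y.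
  move=> y1 yb; have [u [u1 uy yE]] := meridianP m2 y01 y1.
  rewrite yE; have [wu|wu] := ltP (-1) (dot w0 u).
    exact: agree_path wu agree_z.
  (* For the direction opposite to w0, a detour through w1: here m > 2 matters. *)
  have {}wu : w0 = - u.
    by apply: dot_eqN1 => //; apply/eqP; rewrite eq_le wu dot_geN1.
  have agree_1 : s1 (meridian y0 a0 w1) = s2 (meridian y0 a0 w1).
    apply: (agree_path a0 a0 w0 w1) => //.
    by rewrite dotC w10 ltrN10.
  apply: (agree_path a0 _ w1 u) => //.
  by rewrite -(opprK u) -wu dotNr w10 oppr0 ltrN10.
pose g y := if -1 + d < dot y0 (normalize y) then s1 y else s2 y.
have gP y : y != 0 -> {for y, continuous g} /\ f (g y) = normalize y.
  move=> yn0.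
  have cN := @continuous_normalize R m E id y yn0 (@continuous_id_at E y).
  have cd : {for y, continuous (fun x : E => dot y0 (normalize x))}.
    exact: (continuous_dot (@cst_continuous _ _ y0 y) cN).
  have [yd|yd] := ltP (-1 + d) (dot y0 (normalize y)).
    have [cs fs] := s1P y yn0 yd; split; last by rewrite /g yd.
    have H : \forall x \near y, s1 x = g x.
      have Hd : \forall x \near y, -1 + d < dot y0 (normalize x).
        exact: (cvgr_gt _ cd _ yd).
      by apply: filterS Hd => x xd; rewrite /g xd.
    exact: near_eq_continuous H cs.
  have yb : dot y0 (normalize y) < -1 + b.
    by apply: le_lt_trans yd _; rewrite /d; lra.
  have [cs fs] := s2P y yn0 yb; split; last by rewrite /g ltNge yd.
  have Hn0 : \forall x \near y, 0 < dot x x.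
    have cid := @continuous_id_at E y.
    by apply: (cvgr_gt _ (continuous_dot cid cid)); exact: dot_gt0.
  have H : \forall x \near y, s2 x = g x.
    have Hd : \forall x \near y, dot y0 (normalize x) < -1 + b.
      exact: (cvgr_lt _ cd _ yb).
    apply: filterS2 Hn0 Hd => x x0 xb.
    rewrite /g; case: ifP => // xd.
    have xn0 : x != 0 by rewrite -dot_eq0 gt_eqF.
    have := agree (normalize x) (dot_normalize xn0) ltac:(exact/andP).
    by rewrite /s1 /s2 normalize_unit // dot_normalize.
  exact: near_eq_continuous H cs.
exists g; split=> [q'|y y1]; last first.
  by have [_ ->] := gP y (dot1_neq0 y1); rewrite normalize_unit.
have := @unique_lift M M E f setT (g \o f) id p M_hausdorff f_inj M_connected.
apply=> //.
- move=> x _; have [cg _] := gP (f x) (dot1_neq0 (f_unit x)).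
  exact: (@continuous_comp _ _ _ f g x (@f_continuous x) cg).
- by move=> x _; exact: continuous_id_at.
- move=> x _ /=; have [_ ->] := gP (f x) (dot1_neq0 (f_unit x)).
  by rewrite normalize_unit.
- have d1 : -1 + d < 1 by rewrite /d; lra.
  by rewrite /= -/y0 /g /s1 (normalize_unit y01) y01 d1 s_p.
Qed.

End Covering.

(** * Lengths of curves on the sphere *)

Section Length.
Context {R : realType} {m : nat}.
Local Notation E := ('rV[R]_m).
Local Notation mu := (@lebesgue_measure R).


(** A tangent vector u at x only sees the component of y orthogonal to x. *)
Lemma tangent_dot_le (x y u : E) : dot x x = 1 -> dot y y = 1 -> dot u x = 0 ->
  dot u y ^+ 2 <= dot u u * (1 - dot x y ^+ 2).
Proof.
move=> x1 y1 ux; have := Cauchy_Schwarz u (y - dot x y *: x).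
have -> : dot u (y - dot x y *: x) = dot u y by rewrite !dotE ux; ring.
suff -> : dot (y - dot x y *: x) (y - dot x y *: x) = 1 - dot x y ^+ 2 by [].
by rewrite !dotE x1 y1 (dotC y x); ring.
Qed.

Lemma is_derive_dot (V : normedModType R) (f g : V -> E) (x v : V) :
  differentiable f x -> differentiable g x ->
  is_derive x v (fun y => dot (f y) (g y))
    (dot ('D_v f x) (g x) + dot (f x) ('D_v g x)).
Proof.
move=> df dg.
have dc j : is_derive x v ((fun y => f y 0 j) * (fun y => g y 0 j))
    (f x 0 j *: 'D_v g x 0 j + g x 0 j *: 'D_v f x 0 j).
  rewrite !derive_coord //; apply: is_deriveM;
  by apply: derivableP; exact/diff_derivable/differentiable_coord1.
have := @is_derive_sum _ _ _ _ (fun j y => f y 0 j * g y 0 j) x v _ dc.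
rewrite fct_sumE => H.
apply: is_derive_eq H _; rewrite big_split /= addrC /dot.
by congr (_ + _); apply: eq_bigr => j _; rewrite /GRing.scale //= mulrC.
Qed.

Lemma dot_derive_unit (V : normedModType R) (f : V -> E) (x v : V) :
  differentiable f x -> (\near x, dot (f x) (f x) = 1) ->
  dot ('D_v f x) (f x) = 0.
Proof.
move=> df f1.
have H : 'D_v (fun y => dot (f y) (f y)) x = 'D_v (cst (1 : R)) x.
  exact: near_eq_derive.
have := @derive_val _ _ _ _ _ _ _ (is_derive_dot v df df).
by rewrite H derive_cst (dotC (f x)); lra.
Qed.

Lemma derive1_near (g h : R -> E) (a b t : R) : {in `[a, b], g =1 h} ->
  t \in `]a, b[ -> g^`()%classic t = h^`()%classic t.
Proof.
rewrite in_itv /= => gh /andP[ta tb]; rewrite !derive1E; apply: near_eq_derive.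
have Ha : \forall s \near t, a < s by exact: lt_nbhsr.
have Hb : \forall s \near t, s < b by exact: lt_nbhsl.
by apply: filterS2 Ha Hb => s sa sb; rewrite gh // in_itv /= !ltW.
Qed.

Lemma smooth_derive1 (h : R -> E) : smooth_on setT h ->
  (forall t : R, differentiable h t) /\ continuous (h^`()%classic).
Proof.
move=> sh; have [d1 /(_ 1) [d2 _]] := sh 2; split=> [t|t]; first exact: d1.
rewrite (_ : h^`()%classic = 'D_1 h); first exact/differentiable_continuous/d2.
by apply/funext => s; rewrite derive1E.
Qed.

Lemma enorm_continuous (T : topologicalType) (f : T -> E) (x : T) :
  {for x, continuous f} -> {for x, continuous (fun y : T => enorm (f y))}.
Proof.
move=> cf; exact: (continuous_comp (continuous_dot cf cf) (@sqrt_continuous R _)).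
Qed.

(** The angle to y, acos (dot h y), is not differentiable where h meets y or - y.
  The factor k < 1 cures this and only decreases the speed. *)
Lemma angle_speed (h : R -> E) (y : E) (k t : R) : 0 < k < 1 ->
  differentiable h t -> (\near t, dot (h t) (h t) = 1) -> dot y y = 1 ->
  is_derive t 1 (fun s => acos (k * dot (h s) y))
    (- (Num.sqrt (1 - (k * dot (h t) y) ^+ 2))^-1 * (k * dot (h^`()%classic t) y)) /\
  (Num.sqrt (1 - (k * dot (h t) y) ^+ 2))^-1 * (k * dot (h^`()%classic t) y)
    <= enorm (h^`()%classic t).
Proof.
move=> /andP[k0 k1] dh h1 y1; have ht1 := nbhs_singleton h1.
have c1 := dot_le1 ht1 y1; have c2 := dot_geN1 ht1 y1.
have kc : -1 < k * dot (h t) y < 1 by apply/andP; split; nra.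
have dk : is_derive t 1 (fun s => k * dot (h s) y) (k * dot (h^`()%classic t) y).
  have Hd := is_derive_dot (1 : R) dh (differentiable_cst y t).
  rewrite derive_cst dot0r addr0 -derive1E in Hd.
  exact: (is_deriveZ k Hd).
split.
  exact: (@is_derive1_comp R (@acos R) (fun s => k * dot (h s) y) t _ _
    (is_derive1_acos kc) dk).
set u := h^`()%classic t.
have ux : dot u (h t) = 0 by rewrite /u derive1E; exact: dot_derive_unit.
have H := tangent_dot_le ht1 y1 ux.
set c := dot (h t) y in kc H c1 c2 *; set w := dot u y in H *.
have s0 : 0 < 1 - (k * c) ^+ 2.
  have -> : 1 - (k * c) ^+ 2 = (1 - k * c) * (1 + k * c) by ring.
  by move: kc => /andP[? ?]; rewrite mulr_gt0 //; lra.
rewrite mulrC ler_pdivrMr ?sqrtr_gt0 // /enorm -sqrtrM ?dot_ge0 //.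
apply: le_trans (ler_norm _) _; rewrite -sqrtr_sqr ler_wsqrtr // exprMn.
apply: (@le_trans _ _ (k ^+ 2 * (dot u u * (1 - c ^+ 2)))).
  by rewrite ler_wpM2l // sqr_ge0.
rewrite mulrCA ler_wpM2l ?dot_ge0 // mulrBr mulr1 exprMn lerD2r.
by rewrite expr_le1 // ltW.
Qed.

Lemma length_piece (g h : R -> E) (y : E) (k a b : R) : 0 < k < 1 -> a < b ->
  smooth_on setT h -> {in `[a, b], g =1 h} ->
  (forall t, t \in `[a, b] -> dot (g t) (g t) = 1) -> dot y y = 1 ->
  [/\ measurable_fun `]a, b]%classic (EFin \o (fun t => enorm (g^`()%classic t))),
      (\int[mu]_(t in `]a, b]) (enorm (g^`()%classic t))%:E < +oo)%E &
      ((acos (k * dot (g a) y) - acos (k * dot (g b) y))%:E <=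
        \int[mu]_(t in `]a, b]) (enorm (g^`()%classic t))%:E)%E].
Proof.
move=> k01 ab /smooth_derive1 [dh ch'] gh g1 y1.
have h1 (t : R) : t \in `[a, b] -> dot (h t) (h t) = 1 by move=> tab; rewrite -gh // g1.
have /andP[k0 k1] := k01.
have ch (t : R) : {for t, continuous h} by exact/differentiable_continuous/dh.
have cd (t : R) : {for t, continuous (fun s : R => k * dot (h s) y)}.
  by apply: cvgM; [exact: cvg_cst|exact: (continuous_dot (ch t) (@cst_continuous _ _ y t))].
have kc (t : R) : t \in `[a, b] -> -1 < k * dot (h t) y < 1.
  move=> tab; have c1 := dot_le1 (h1 t tab) y1; have c2 := dot_geN1 (h1 t tab) y1.
  by apply/andP; split; nra.
pose e (t : R) := enorm (h^`()%classic t).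
have ce : continuous e by move=> t; apply: enorm_continuous; exact: ch'.
pose w (t : R) : R :=
  (Num.sqrt (1 - (k * dot (h t) y) ^+ 2))^-1 * (k * dot (h^`()%classic t) y).
have cw (t : R) : t \in `[a, b] -> {for t, continuous w}.
  move=> tab; apply: cvgM.
    apply: cvgV.
      rewrite gt_eqF // sqrtr_gt0.
      have -> : 1 - (k * dot (h t) y) ^+ 2 =
        (1 - k * dot (h t) y) * (1 + k * dot (h t) y) by ring.
      by have /andP[? ?] := kc t tab; rewrite mulr_gt0 //; lra.
    have c2 : {for t, continuous (fun s : R => 1 - (k * dot (h s) y) ^+ 2)}.
      by apply: cvgB; [exact: cvg_cst|rewrite !expr2; apply: cvgM; exact: cd].
    exact: (continuous_comp c2 (@sqrt_continuous R _)).
  by apply: cvgM; [exact: cvg_cst|exact: (continuous_dot (ch' t) (@cst_continuous _ _ y t))].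
have speed (t : R) : t \in `]a, b[ ->
    is_derive t 1 (fun s => acos (k * dot (h s) y)) (- w t) /\ w t <= e t.
  move=> tab; have hn1 : \near t, dot (h t) (h t) = 1.
    move: (tab); rewrite in_itv /= => /andP[ta tb].
    have Ha : \forall s \near t, a < s by exact: lt_nbhsr.
    have Hb : \forall s \near t, s < b by exact: lt_nbhsl.
    by apply: filterS2 Ha Hb => s sa sb; rewrite h1 // in_itv /= !ltW.
  have [D1 D2] := angle_speed k01 (dh t) hn1 y1; split=> //.
  by apply: is_derive_eq D1 _; rewrite /w mulNr.
have Iw : mu.-integrable `[a, b]%classic (EFin \o w).
  apply: continuous_compact_integrable; first exact: segment_compact.
  by apply: continuous_in_subspaceT => t; rewrite inE; exact: cw.
have Ie : mu.-integrable `[a, b]%classic (EFin \o e).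
  apply: continuous_compact_integrable; first exact: segment_compact.
  by apply: continuous_in_subspaceT => t _; exact: ce.
have sub : `]a, b[%classic `<=` `[a, b]%classic by exact: subset_itv_oo_cc.
have Iwo : mu.-integrable `]a, b[%classic (EFin \o w) by apply: integrableS Iw.
have Ieo : mu.-integrable `]a, b[%classic (EFin \o e) by apply: integrableS Ie.
have ef : {in `]a, b[%classic, (EFin \o e) =1 (EFin \o (fun t => enorm (g^`()%classic t)))}.
  by move=> t; rewrite inE /= => tab; rewrite (derive1_near gh tab).
have mfo : measurable_fun `]a, b[%classic (EFin \o (fun t => enorm (g^`()%classic t))).
  exact: eq_measurable_fun ef (measurable_int mu Ieo).
have fE : (\int[mu]_(t in `]a, b]) (enorm (g^`()%classic t))%:E =
           \int[mu]_(t in `]a, b[) (e t)%:E)%E.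
  transitivity (\int[mu]_(t in `]a, b[) (EFin \o (fun t => enorm (g^`()%classic t))) t)%E.
    exact: (@integral_itv_bndoo R a b _ false false mfo).
  by apply: eq_integral => t tab; exact: esym (ef t tab).
split.
- exact/emeasurable_fun_itv_bndo_bndcP.
- by rewrite fE; exact: integrable_lty Ieo.
rewrite fE; have FTC : (\int[mu]_(t in `[a, b]) (w t)%:E =
    (- acos (k * dot (h b) y))%:E - (- acos (k * dot (h a) y))%:E)%E.
  have cacos (t : R) : t \in `[a, b] ->
      (fun s : R => - acos (k * dot (h s) y)) s @[s --> t] --> - acos (k * dot (h t) y).
    move=> tab; apply: cvgN.
    exact: (continuous_comp (cd t) (continuous_acos (kc t tab))).
  have F2 := @continuous_FTC2 R w (fun s => - acos (k * dot (h s) y)) a b ab.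
  apply: F2.
  - by apply: continuous_in_subspaceT => t; rewrite inE; exact: cw.
  - split.
    + by move=> t /speed [[D _] _]; exact: derivableN.
    + by apply: cvg_at_right_filter; apply: cacos; rewrite in_itv /= lexx ltW.
    + by apply: cvg_at_left_filter; apply: cacos; rewrite in_itv /= lexx ltW.
  - move=> t /speed [[D DE] _]; rewrite derive1E.
    by rewrite (deriveN D) DE opprK.
have -> : g a = h a by apply: gh; rewrite in_itv /= lexx ltW.
have -> : g b = h b by apply: gh; rewrite in_itv /= lexx ltW.
apply: (@le_trans _ _ (\int[mu]_(t in `[a, b]) (w t)%:E)%E).
  by rewrite FTC -EFinB lee_fin; lra.
have -> : (\int[mu]_(t in `[a, b]) (w t)%:E = \int[mu]_(t in `]a, b[) (w t)%:E)%E.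
  exact: (@integral_itv_bndoo R a b _ true false (measurable_int mu Iwo)).
have le_we : {in `]a, b[%classic, forall t : R, ((w t)%:E <= (e t)%:E)%E}.
  by move=> t; rewrite inE /= => /speed [_]; rewrite lee_fin.
exact: (@le_integral _ _ _ mu `]a, b[%classic (measurable_itv _) _ _ Iwo Ieo le_we).
Qed.

(** Half-open intervals make the pieces disjoint; at the subdivision points the
  derivative is junk, which is harmless for the integral.  Nonnegative extended
  integrals need no integrability, so finiteness comes out of the induction. *)
Lemma length_pieces (g : R -> E) (y : E) (k a : R) (s : seq R) : 0 < k < 1 ->
  path <%R a s ->
  (forall i, (i < size s)%N ->
     exists2 h : R -> E, smooth_on setT h &
       {in `[nth 0 (a :: s) i, nth 0 s i], g =1 h}) ->
  (forall t, t \in `[a, last a s] -> dot (g t) (g t) = 1) -> dot y y = 1 ->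
  [/\ measurable_fun `]a, last a s]%classic (EFin \o (fun t => enorm (g^`()%classic t))),
      (\int[mu]_(t in `]a, last a s]) (enorm (g^`()%classic t))%:E < +oo)%E &
      ((acos (k * dot (g a) y) - acos (k * dot (g (last a s)) y))%:E <=
        \int[mu]_(t in `]a, last a s]) (enorm (g^`()%classic t))%:E)%E].
Proof.
move=> k01; elim: s a => [|c s IH] a /=.
  move=> _ _ _ _; rewrite subrr set_itvoc0; split=> //.
  - exact: measurable_fun_set0.
  - by rewrite integral_set0 ltry.
  - by rewrite integral_set0.
move=> /andP[ac cs] pieces g1 y1.
have cb : c <= last c s.
  by move: cs; rewrite lt_path_sortedE => /andP[/allP H _]; case: (s) H => //= b s' H;
     apply/ltW/H; rewrite mem_last.
have sub_ac t : t \in `[a, c] -> t \in `[a, last c s].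
  by rewrite !in_itv /= => /andP[-> tc]; exact: le_trans tc cb.
have sub_cb t : t \in `[c, last c s] -> t \in `[a, last c s].
  by rewrite !in_itv /= => /andP[ct ->]; rewrite andbT; exact: le_trans (ltW ac) ct.
have [h sh gh] := pieces 0%N isT.
have [m1 l1 b1] := length_piece k01 ac sh gh
  (fun t tac => g1 t (sub_ac t tac)) y1.
have [m2 l2 b2] := IH c cs (fun i => pieces i.+1)
  (fun t tcb => g1 t (sub_cb t tcb)) y1.
have U : `]a, last c s]%classic = `]a, c]%classic `|` `]c, last c s]%classic.
  by rewrite -itv_bndbnd_setU ?bnd_simp // ltW.
have mU : measurable_fun (`]a, c]%classic `|` `]c, last c s]%classic)
    (EFin \o (fun t => enorm (g^`()%classic t))).
  by apply/measurable_funU => //; split.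
have dis : [disjoint `]a, c]%classic & `]c, last c s]%classic].
  apply/disj_setPS => t /=; rewrite !in_itv /= => -[/andP[_ tc] /andP[ct _]].
  by move: (lt_le_trans ct tc); rewrite ltxx.
have IU : (\int[mu]_(t in `]a, last c s]) (enorm (g^`()%classic t))%:E =
    \int[mu]_(t in `]a, c]) (enorm (g^`()%classic t))%:E +
    \int[mu]_(t in `]c, last c s]) (enorm (g^`()%classic t))%:E)%E.
  rewrite U; apply: (@ge0_integral_setU _ _ _ mu _ _ _ _ _ mU) => //.
  by move=> t _; rewrite lee_fin sqrtr_ge0.
split; first by rewrite U.
  by rewrite IU lte_add_pinfty.
rewrite IU; apply: le_trans (leeD b1 b2).
by rewrite -EFinD lee_fin; lra.
Qed.

Lemma curve_length_ge_angle (g : R -> E) (y : E) (k : R) : 0 < k < 1 ->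
  piecewise_smooth g -> (forall t, t \in `[0, 1] -> usphere R m (g t)) ->
  dot y y = 1 ->
  acos (k * dot (g 0) y) - acos (k * dot (g 1) y) <= curve_length g.
Proof.
move=> k01 [s [p01 l1 pieces]] g1 y1.
have g1' t : t \in `[0, last 0 s] -> dot (g t) (g t) = 1.
  by rewrite l1 => /g1; rewrite usphereE.
have [mf lf bf] := length_pieces k01 p01 pieces g1' y1.
rewrite l1 in mf lf bf.
rewrite /curve_length /Rintegral -lee_fin fineK.
  by rewrite -(integral_itv_obnd_cbnd mf).
rewrite -(integral_itv_obnd_cbnd mf) ge0_fin_numE //.
by apply: integral_ge0 => t _; rewrite lee_fin sqrtr_ge0.
Qed.

(** The family of these functions is stable under derivation. *)
Lemma Ck_on_trig (p q w : R) k :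
  Ck_on k setT (fun t : R => p * cos (w * t) + q * sin (w * t)).
Proof.
pose f (p q t : R) := p * cos (w * t) + q * sin (w * t).
rewrite -/(f p q); move: p q.
have D (p q t : R) : is_derive t 1 (f p q) (f (w * q) (- (w * p)) t).
  have dw : is_derive t 1 (fun t : R => w * t) w.
    by rewrite -[X in is_derive _ _ _ X]mulr1; exact: is_deriveZ.
  have dc := @is_derive1_comp R cos _ t _ _ (is_derive_cos (w * t)) dw.
  have ds := @is_derive1_comp R sin _ t _ _ (is_derive_sin (w * t)) dw.
  have := is_deriveD (is_deriveZ p dc) (is_deriveZ q ds).
  move=> H; apply: is_derive_eq H _.
  by rewrite /f /GRing.scale /=; ring.
have df (p q t : R) : differentiable (f p q) t.
  by apply/derivable1_diffP; have [] := D p q t.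
elim: k => [|k IH] p q.
  by move=> t _; exact/differentiable_continuous/df.
split=> [t _|v]; first exact: df.
have -> : (fun t => 'D_v (f p q) t) = f (v * (w * q)) (v * (- (w * p))); last exact: IH.
apply/funext => t; rewrite deriveE // -[v]mulr1 linearZ /= -deriveE //.
by rewrite (@derive_val _ _ _ _ _ _ _ (D p q t)) /f /GRing.scale /= mulr1; ring.
Qed.

(** This serves to see that the infimum defining the distance is not taken over the
  empty set, where it would be 0. *)
Lemma great_circle (x y : E) : (2 < m)%N -> dot x x = 1 -> dot y y = 1 ->
  exists g : R -> E, [/\ smooth_on setT g, forall t, dot (g t) (g t) = 1,
    g 0 = x & g 1 = y].
Proof.
move=> m2 x1 y1; set c := dot x y.
have cI : -1 <= c <= 1 by rewrite dot_le1 // dot_geN1.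
have [u [u1 ux yE]] := meridianP m2 x1 y1.
exists (fun t => cos (acos c * t) *: x + sin (acos c * t) *: u); split.
- move=> k; apply: Ck_on_coordwise; first exact: openT.
  move=> j; have := Ck_on_trig (x 0 j) (u 0 j) (acos c) k.
  by congr (Ck_on _ _ _); apply/funext => t; rewrite !mxE !(mulrC (x 0 j)) !(mulrC (u 0 j)).
- move=> t; rewrite !dotE x1 u1 ux (dotC x) ux.
  by have := cos2Dsin2 (acos c * t); rewrite !expr2; lra.
- by rewrite mulr0 cos0 sin0 scale1r scale0r addr0.
- by rewrite [RHS]yE mulr1 acosK ?in_itv //= sin_acos.
Qed.

(** Curves of length L from x to y satisfy acos (k (x.y)) - acos k <= L for all
  k < 1, hence this holds with L = rho.  For k = cos t it becomes
  cos (rho + t) <= cos t (x.y), and t tends to 0. *)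
Lemma geodesic_ball_cap (x y : E) (rho : R) : (2 < m)%N -> 0 < rho < pi ->
  usphere R m y -> geodesic_ball y rho x -> cos rho <= dot x y.
Proof.
move=> m2 /andP[rho0 rhopi]; rewrite usphereE => y1 [].
rewrite usphereE => x1 dist; set c := dot x y.
have [cI1 cI2] : -1 <= c /\ c <= 1 by split; [exact: dot_geN1|exact: dot_le1].
have angle k : 0 < k < 1 -> acos (k * c) - acos k <= rho.
  move=> k01; apply: le_trans dist; apply: lb_le_inf.
    have [g [sg g1 g0x g1y]] := great_circle m2 x1 y1.
    exists (curve_length g), g; split=> //; last by move=> t _; rewrite usphereE.
    exists [:: 1]; split=> //=; first by rewrite ltr01.
    by case=> // _; exists g.
  move=> L [g [pg Sg g0x g1y ->]].
  by have := curve_length_ge_angle k01 pg Sg y1; rewrite g0x g1y y1 mulr1.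
rewrite leNgt; apply/negP => crho.
(* acos (cos t * c) <= rho + t means that psi is nonnegative for small t > 0, while
  the assumption makes it negative at 0. *)
pose psi (t : R) := cos t * c - cos (rho + t).
have cpsi : {for 0, continuous psi}.
  apply: cvgB.
    by apply: cvgM; [exact: continuous_cos|exact: cvg_cst].
  have ct : {for 0, continuous (fun t : R => rho + t)}.
    by apply: cvgD; [exact: cvg_cst|exact: cvg_id].
  exact: (continuous_comp ct (@continuous_cos R _)).
have psi0 : psi 0 < 0 by rewrite /psi cos0 addr0; lra.
have Hpsi : \forall t \near 0, psi t < 0 by exact: (cvgr_lt _ cpsi _ psi0).
have [t [t0 [tp [tr pt]]]] : exists t : R, 0 < t /\ t < pi / 2 /\ t < pi - rho /\ psi t < 0.
  have H1 : \forall t \near (0 : R)^'+, 0 < t by exact: nbhs_right_gt.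
  have H2 : \forall t \near (0 : R)^'+, t < pi / 2.
    by apply: nbhs_right_lt; rewrite divr_gt0 // pi_gt0.
  have H3 : \forall t \near (0 : R)^'+, t < pi - rho by apply: nbhs_right_lt; lra.
  have H4 : \forall t \near (0 : R)^'+, psi t < 0 by exact: cvg_at_right_filter Hpsi.
  have [t [[[? ?] ?] ?]] := filter_ex (filterI (filterI (filterI H1 H2) H3) H4).
  by exists t.
have pi0 := pi_gt0 R.
have k0 : 0 < cos t by apply: cos_gt0_pihalf; apply/andP; split; lra.
have tI : t \in `[0, pi] by rewrite in_itv /=; apply/andP; split; lra.
have k1 : cos t < 1.
  by rewrite -(cos0 R) ltr_cos // in_itv /= lexx ltW.
have := angle (cos t) ltac:(exact/andP); rewrite cosK // => H.
have kc : -1 <= cos t * c <= 1 by apply/andP; split; nra.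
have : cos (rho + t) <= cos t * c.
  rewrite -[leRHS]acosK; last by rewrite in_itv.
  rewrite leNgt ltr_cos -?leNgt ?in_itv /= ?acos_ge0 ?acos_lepi //; first lra.
  by apply/andP; split; lra.
by move: pt; rewrite /psi; lra.
Qed.

End Length.

(** * Smooth maps on manifolds *)

Section Charts.
Context {R : realType} {n : nat} {M : smoothManifold R n}.
Implicit Types (c d : chart R n M) (p q : M).

Lemma par_continuous c u : (coord c @` dom c) u -> {for u, continuous (par c)}.
Proof.
move=> Ou; have := @par_continuous_on _ _ _ c.
rewrite (continuous_open_subspace _ (@codom_open _ _ _ c)) => H.
by apply: H; rewrite inE.
Qed.

Lemma coord_continuous_at c p : dom c p -> {for p, continuous (coord c)}.
Proof.
move=> cp; have := @coord_continuous_on _ _ _ c.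
rewrite (continuous_open_subspace _ (@dom_open _ _ _ c)) => H.
by apply: H; rewrite inE.
Qed.

Lemma open_chart_image c (W : set M) : open W ->
  open (coord c @` (dom c `&` W)).
Proof.
move=> oW; rewrite openE => u [p [cp Wp] <-].
have Op : (coord c @` dom c) (coord c p) by exists p.
have H1 : \forall u \near coord c p, (coord c @` dom c) u.
  by apply: open_nbhs_nbhs; split=> //; exact: codom_open.
have H2 : \forall u \near coord c p, W (par c u).
  apply: (par_continuous Op); rewrite coordK_on //.
  exact: open_nbhs_nbhs.
rewrite /interior /=; apply: filterS2 H1 H2 => v [q cq <-].
by rewrite coordK_on // => Wq; exists q.
Qed.

Lemma smooth_map_continuous m (f : M -> 'rV[R]_m) : smooth_map f -> continuous f.
Proof.
move=> sf p; have [c ac cp] := atlas_cover p.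
have Op : (coord c @` dom c) (coord c p) by exists p.
have cf : {for coord c p, continuous (f \o par c)} := sf c ac 0%N _ Op.
have := continuous_comp (coord_continuous_at cp) cf.
apply: near_eq_continuous.
have : \forall q \near p, dom c q by apply: open_nbhs_nbhs; split=> //; exact: dom_open.
by apply: filterS => q cq /=; rewrite coordK_on.
Qed.

End Charts.

Section LocalInverse.
Context {R : realType} {n : nat} {M : smoothManifold R n}.

(** Dropping the coordinate 0, as a matrix so that the calculus of u *m B applies. *)
Definition tail_mx m : 'M[R]_(m.+1, m) := \matrix_(i, j) (i == lift ord0 j)%:R.

Lemma mul_tail_mx m (u : 'rV[R]_m.+1) j :
  (u *m tail_mx m) 0 j = u 0 (lift ord0 j).
Proof.
rewrite mxE (bigD1 (lift ord0 j)) //= mxE eqxx mulr1 big1 ?addr0 // => i.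
by rewrite mxE => /negbTE ->; rewrite mulr0.
Qed.

Definition cons_rV (r : R) (v : 'rV[R]_n) : 'rV[R]_n.+1 :=
  \row_i (if unlift ord0 i is Some j then v 0 j else r).

Lemma cons_rV0 r v : cons_rV r v 0 0 = r.
Proof. by rewrite mxE unlift_none. Qed.

Lemma tail_cons_rV r v : cons_rV r v *m tail_mx n = v.
Proof. by apply/rowP => j; rewrite mul_tail_mx mxE liftK. Qed.

Lemma cons_rV_eta (w : 'rV[R]_n.+1) : w = cons_rV (w 0 0) (w *m tail_mx n).
Proof.
apply/rowP => i; rewrite mxE; case: unliftP => [j ->|->] //.
by rewrite mul_tail_mx.
Qed.

(** The differential of the cone map (t, u) |-> t f(u) is invertible: its radial
  part is along f and its other part is orthogonal to f, because f has unit
  length.  The inverse of the cone map, followed by the projection to u, restricts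
  to an inverse of f on the sphere and extends it smoothly to the ambient space. *)
Lemma local_smooth_inverse (f : M -> 'rV[R]_n.+1) (c : chart R n M) (p : M) :
  smooth_map f -> (forall q, dot (f q) (f q) = 1) -> atlas M c -> dom c p ->
  (forall v, chart_derive c f p v = 0 -> v = 0) ->
  exists (W : set M) (V : set 'rV[R]_n.+1) (kappa : 'rV[R]_n.+1 -> 'rV[R]_n),
    [/\ local_inverse f p W V (par c \o kappa), smooth_on V kappa &
        forall y, V y -> (coord c @` dom c) (kappa y)].
Proof.
move=> sf f1 ac cp inj.
set D := coord c @` dom c; have oD : open D := @codom_open _ _ _ c.
have Dp : D (coord c p) by exists p.
pose tl (w : 'rV[R]_n.+1) : 'rV[R]_n := w *m tail_mx n.
pose hd (w : 'rV[R]_n.+1) : R := w 0 0.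
pose fc := f \o par c.
pose Phi w := hd w *: fc (tl w).
pose Om := [set w | 0 < hd w /\ D (tl w)].
have ctl : continuous tl by exact: continuous_mulmxr.
have chd : continuous hd by move=> w; exact: coord_continuous.
have oOm : open Om.
  have := openI (open_comp (D := [set t : R | 0 < t]) (fun w _ => @chd w) (@open_gt R 0))
    (open_comp (fun w _ => @ctl w) oD).
  by [].
pose a := cons_rV 1 (coord c p).
have hda : hd a = 1 by exact: cons_rV0.
have tla : tl a = coord c p by exact: tail_cons_rV.
have Oma : Om a by rewrite /Om /= hda tla.
have stl k : Ck_on k Om tl by exact: (Ck_on_mulmxr (tail_mx n) oOm (@Ck_on_id _ _ _ _)).
have shd k : Ck_on k Om hd by exact: (Ck_on_coord 0 oOm (@Ck_on_id _ _ _ _)).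
have sfc k : Ck_on k D fc by exact: sf.
have sft k : Ck_on k Om (fc \o tl).
  by apply: (Ck_on_comp oOm oD _ (stl k) (sfc k)) => w [].
have sPhi : smooth_on Om Phi.
  by move=> k; exact: (Ck_on_scale oOm (shd k) (sft k)).
have [dfc _] := sfc 1%N; have [dtl _] := stl 1%N; have [dhd _] := shd 1%N.
have [dft _] := sft 1%N.
have injPhi w : 'D_w Phi a = 0 -> w = 0.
  have [_ ->] := derive_scale w (dhd a Oma) (dft a Oma).
  have -> : 'D_w hd a = hd w.
    rewrite -(derive_coord w 0 (@differentiable_id _ _ a)).
    by rewrite derive_id.
  rewrite hda scale1r /= tla.
  have Dtl : 'D_w tl a = tl w.
    by rewrite (derive_mulmxr (tail_mx n) (differentiable_id a)).2 derive_id.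
  have dfa : differentiable fc (tl a) by apply: dfc; rewrite tla.
  rewrite (derive_comp w (dtl a Oma) dfa) Dtl tla => H.
  have Hd : dot ('D_(tl w) fc (coord c p)) (fc (coord c p)) = 0.
    apply: dot_derive_unit; first exact: dfc.
    by near=> u; exact: f1.
  have := congr1 (fun u => dot u (fc (coord c p))) H.
  rewrite dotDl dotZl Hd f1 dot0l mulr1 addr0 => w0.
  rewrite w0 scale0r add0r in H.
  rewrite [w]cons_rV_eta -/(tl w) -/(hd w) w0 (inj _ H).
  by apply/rowP => i; rewrite !mxE; case: unliftP => // j _; rewrite mxE.
have [U [V [psi [[oU Ua UOm oV Va] [Uinj psiP spsi]]]]] :=
  inverse_function oOm Oma sPhi injPhi.
have Phia : Phi a = f p by rewrite /Phi hda scale1r tla /fc /= coordK_on.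
pose W := dom c `&` [set q | U (cons_rV 1 (coord c q))].
have ccons : continuous (cons_rV 1).
  move=> v; apply: (@Ck_on_coordwise R _ _ 0 setT (cons_rV 1) openT) => // j u _.
  case: (unliftP ord0 j) => [i ->|->].
    rewrite (_ : (fun x => _) = fun x : 'rV[R]_n => x 0 i); first exact: coord_continuous.
    by apply/funext => x; rewrite mxE liftK.
  rewrite (_ : (fun x => _) = cst 1); first exact: cst_continuous.
  by apply/funext => x; rewrite cons_rV0.
exists W, V, (tl \o psi).
have kD y : V y -> D (tl (psi y)) by move=> /psiP [/UOm []].
have PhiE q : dom c q -> Phi (cons_rV 1 (coord c q)) = f q.
  move=> cq; rewrite /Phi /hd /tl cons_rV0 tail_cons_rV scale1r /fc /=.
  by rewrite coordK_on.
split=> //.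
  split.
  - split.
    + rewrite openE => q [cq Uq]; rewrite /interior /=.
      have H1 : \forall q' \near q, dom c q'.
        by apply: open_nbhs_nbhs; split=> //; exact: dom_open.
      have cc := continuous_comp (coord_continuous_at cq) (@ccons _).
      have H2 : \forall q' \near q, U (cons_rV 1 (coord c q')).
        by apply: cc; exact: open_nbhs_nbhs.
      by apply: filterS2 H1 H2.
    + by split.
    + move=> q q' [cq Uq] [cq' Uq'] E.
      have := Uinj _ _ Uq Uq'; rewrite !PhiE // => /(_ E).
      move=> /(congr1 tl); rewrite /tl !tail_cons_rV => /(congr1 (par c)).
      by rewrite !coordK_on.
  - by rewrite -Phia.
  - move=> y Vy y1; have [Uy Phiy] := psiP y Vy; have [h0 Dy] := UOm _ Uy.
    have h1 : hd (psi y) = 1.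
      have : dot (Phi (psi y)) (Phi (psi y)) = 1 by rewrite Phiy.
      rewrite /Phi dotZl dotZr f1 mulr1 -expr2; move/eqP.
      rewrite sqrf_eq1 => /orP[/eqP //|/eqP H].
      by move: h0; rewrite H oppr_gt0 ltr10.
    case: (Dy) => q cq qE.
    have psiE : psi y = cons_rV 1 (coord c q).
      by rewrite [LHS]cons_rV_eta -/(hd _) h1 qE.
    rewrite /= -qE coordK_on //; split; first by split; rewrite //= -psiE.
    by rewrite -Phiy psiE PhiE.
  - move=> y Vy; have cpsi : {for y, continuous psi} := spsi 0%N y Vy.
    have ck := continuous_comp cpsi (@ctl _).
    exact: (continuous_comp ck (par_continuous (kD y Vy))).
move=> k; exact: (Ck_on_mulmxr (tail_mx n) oV (spsi k)).
Unshelve. all: by end_near. Qed.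

End LocalInverse.

(** Since f is injective, its global inverse g coincides near y, on the sphere, with
  any local inverse around g(y), and the latter has a smooth extension. *)
Lemma immersion_to_sphere_diffeomorphic (R : realType) (n : nat) (hn : (2 <= n)%N)
    (M : smoothManifold R n) (p0 : M) (f : M -> 'rV[R]_n.+1) :
  compact [set: M] -> connected [set: M] -> smooth_map f ->
  (forall p, dot (f p) (f p) = 1) ->
  (forall p, exists c, [/\ atlas M c, dom c p &
     forall v, chart_derive c f p v = 0 -> v = 0]) ->
  diffeomorphic_to M (usphere R n.+1).
Proof.
move=> cM coM sf f1 imm.
have floc p : exists (c : chart R n M) (W : set M) (V : set 'rV[R]_n.+1)
    (kappa : 'rV[R]_n.+1 -> 'rV[R]_n),
    [/\ local_inverse f p W V (par c \o kappa), smooth_on V kappa,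
        forall y, V y -> (coord c @` dom c) (kappa y) & atlas M c].
  have [c [ac cp inj]] := imm p.
  have [W [V [kappa [H1 H2 H3]]]] := local_smooth_inverse sf f1 ac cp inj.
  by exists c, W, V, kappa.
have floc' p : exists W V h, local_inverse f p W V h.
  by have [c [W [V [kappa [H _ _ _]]]]] := floc p; exists W, V, (par c \o kappa).
have fc := smooth_map_continuous sf.
have [g [gf fg]] := local_homeo_sphere_bijective cM coM (@manifold_hausdorff _ _ M)
  f1 fc floc' p0 (hn : (2 < n.+1)%N).
exists f, g; split=> //.
- by split=> // p; rewrite usphereE.
- move=> d y ad; rewrite usphereE => y1 dgy.
  have [c [W [V [kappa [[[oW Wp Winj] [oV Vp] hP _] skappa kD ac]]]]] := floc (g y).
  rewrite fg // in Vp.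
  have gE z : V z -> dot z z = 1 -> g z = par c (kappa z).
    by move=> Vz z1; have [_ /= {1}<-] := hP z Vz z1; rewrite gf.
  pose D := coord c @` (dom c `&` dom d).
  have oD : open D by apply: open_chart_image; exact: dom_open.
  have oU : open (V `&` kappa @^-1` D).
    rewrite openE => z [Vz Dz]; rewrite /interior /=.
    have H1 : \forall z' \near z, V z' by exact: open_nbhs_nbhs.
    have H2 : \forall z' \near z, D (kappa z').
      by apply: (skappa 0%N z Vz); exact: open_nbhs_nbhs.
    by apply: filterS2 H1 H2.
  exists (V `&` kappa @^-1` D), ((coord d \o par c) \o kappa); split=> //.
  + split=> //=; have [q cq qE] := kD y Vp.
    have := gE y Vp y1; rewrite -qE coordK_on // => gy.
    by exists q => //; split=> //; rewrite -gy.
  + move=> k; apply: (Ck_on_comp oU oD).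
    * by move=> z [].
    * by apply: Ck_on_sub (skappa k) => z [].
    * exact: (atlas_compatible ac ad).
  + move=> z [Vz Dz]; rewrite usphereE => z1; rewrite gE //; split=> //.
    by case: Dz => q [cq dq] /= <-; rewrite coordK_on.
- by move=> y; rewrite usphereE; exact: fg.
Qed.

(** * Parallel transport of the normal field to a fixed point *)

Section Transport.
Context {R : realType}.

Lemma mulmx_dot m (w e : 'rV[R]_m) : w *m e^T = (dot w e)%:M.
Proof.
apply/matrixP => i j; rewrite !ord1 !mxE mulr1n.
by apply: eq_bigr => k _; rewrite mxE.
Qed.

(** Parallel transport along the geodesic from x to y, for unit vectors x and y
  that are not antipodal. *)
Definition transport m (x y w : 'rV[R]_m) : 'rV[R]_m :=
  w - (dot w y / (1 + dot x y)) *: (x + y).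

Lemma transport_isometry m (x y w : 'rV[R]_m) :
  dot x x = 1 -> dot y y = 1 -> -1 < dot x y -> dot w x = 0 ->
  dot (transport x y w) y = 0 /\
  dot (transport x y w) (transport x y w) = dot w w.
Proof.
move=> x1 y1 xy wx; have n0 : 1 + dot x y != 0 by rewrite gt_eqF //; lra.
split; rewrite /transport !dotE ?x1 ?y1 ?(dotC x w) ?(dotC y w) ?(dotC y x) ?wx.
  by field.
by field.
Qed.

(** Identifies the hyperplane orthogonal to x with a standard Euclidean space:
  transport it to the hyperplane orthogonal to the first basis vector e, or to - e
  if x is closer to - e, so that the transport exists, then drop the coordinate 0. *)
Lemma hyperplane_isometry m (x : 'rV[R]_m.+1) : dot x x = 1 ->
  exists B : 'M[R]_(m.+1, m), forall w, dot w x = 0 ->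
    dot (w *m B) (w *m B) = dot w w.
Proof.
move=> x1.
have [s [s1 xs]] : exists s : R, s ^+ 2 = 1 /\ 0 <= dot x (s *: delta_mx 0 0).
  have [H|/ltW H] := leP 0 (dot x (delta_mx 0 0)).
    by exists 1; rewrite expr1n scale1r.
  by exists (-1); rewrite sqrrN expr1n scaleN1r dotNr oppr_ge0.
pose e : 'rV[R]_m.+1 := s *: delta_mx 0 0.
have e00 : e 0 0 = s by rewrite !mxE !eqxx mulr1.
have ej j : e 0 (lift ord0 j) = 0.
  by rewrite !mxE eq_sym (negbTE (neq_lift _ _)) andbF mulr0.
have dot_e u : dot u e = s * u 0 0.
  rewrite /dot big_ord_recl e00 big1 ?addr0; first by rewrite mulrC.
  by move=> j _; rewrite ej mulr0.
have e1 : dot e e = 1 by rewrite dot_e e00 -expr2.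
pose P : 'M[R]_m.+1 := 1%:M - (1 + dot x e)^-1 *: (e^T *m (x + e)).
have wP w : w *m P = transport x e w.
  rewrite /P mulmxBr mulmx1 -scalemxAr mulmxA mulmx_dot mul_scalar_mx scalerA.
  by rewrite mulrC.
exists (P *m tail_mx m) => w wx; rewrite mulmxA wP.
have [te tt] := transport_isometry x1 e1 (lt_le_trans (ltrN10 R) xs) wx.
rewrite -tt; set u := transport x e w in te *.
have u0 : u 0 0 = 0.
  move: te; rewrite dot_e => /eqP; rewrite mulf_eq0 => /orP[/eqP s0|/eqP //].
  by move: s1; rewrite s0 expr0n => /esym/eqP; rewrite oner_eq0.
rewrite [RHS]/dot big_ord_recl u0 mul0r add0r.
by apply: eq_bigr => j _; rewrite !mul_tail_mx.
Qed.

End Transport.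

Section ShapeOperator.
Context {R : realType}.

Lemma cos_gtN1 (rho : R) : 0 < rho < pi -> -1 < cos rho.
Proof.
move=> /andP[r0 rpi]; rewrite -(cospi R) ltr_cos // in_itv /= ?lexx ?pi_ge0 //.
by rewrite (ltW r0) ltW.
Qed.

(** The quotient is at most tan (r / 2), where r is the angle between x and y,
  because |dot a y| <= sin r and 1 + dot x y = 1 + cos r.  Everything is squared and
  expressed by cos (rho / 2) to avoid introducing r. *)
Lemma half_angle_bound m (x y a : 'rV[R]_m) (rho : R) :
  dot x x = 1 -> dot y y = 1 -> dot a a = 1 -> dot a x = 0 ->
  0 < rho < pi -> cos rho <= dot x y ->
  `|dot a y / (1 + dot x y)| <= tan (rho / 2).
Proof.
move=> x1 y1 a1 ax /andP[r0 rpi]; set c := dot x y => rc.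
have k0 : 0 < cos (rho / 2) by apply: cos_gt0_pihalf; apply/andP; split; lra.
have s0 : 0 < sin (rho / 2) by apply: sin_gt0_pi; apply/andP; split; lra.
have c0 : 0 < 1 + c by have := @cos_gtN1 rho ltac:(exact/andP); lra.
have t0 : 0 <= tan (rho / 2) by exact: divr_ge0 (ltW s0) (ltW k0).
have kk : 2 * cos (rho / 2) ^+ 2 <= 1 + c.
  have -> : 2 * cos (rho / 2) ^+ 2 = 1 + cos rho; last by lra.
  rewrite [in RHS](_ : rho = rho / 2 + rho / 2); last by lra.
  by rewrite cosD; have := cos2Dsin2 (rho / 2); rewrite !expr2; lra.
have tk : 1 - c <= tan (rho / 2) ^+ 2 * (1 + c).
  rewrite /tan expr_div_n mulrAC ler_pdivlMr ?exprn_gt0 //.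
  by rewrite sin2cos2; move: (cos (rho / 2) ^+ 2) kk => K; lra.
rewrite normrM normfV (gtr0_norm c0) ler_pdivrMr //.
have tc0 : 0 <= tan (rho / 2) * (1 + c) := mulr_ge0 t0 (ltW c0).
rewrite -(ler_pXn2r (n := 2)) ?nnegrE //.
rewrite real_normK ?num_real // exprMn.
have := tangent_dot_le x1 y1 ax; rewrite a1 mul1r -/c => H; apply: le_trans H _.
have -> : 1 - c ^+ 2 = (1 - c) * (1 + c) by ring.
by rewrite [_ ^+ 2 as X in _ <= _ * X]expr2 mulrA ler_wpM2r // ltW.
Qed.


Lemma Ck_on_dot (V : normedModType R) m k (U : set V) (f g : V -> 'rV[R]_m) : open U ->
  Ck_on k U f -> Ck_on k U g -> Ck_on k U (fun x => dot (f x) (g x)).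
Proof.
move=> oU Cf Cg; apply: Ck_on_sum => // i _.
by apply: Ck_on_mul => //; exact: Ck_on_coord.
Qed.

(** Differentiating dot eta F = 0 shows that the projection to the tangent space of
  the sphere, in the covariant derivative of eta, does nothing. *)
Lemma derive_normal (n : nat) (M : smoothManifold R n) (F eta : M -> 'rV[R]_n.+2)
    (c : chart R n M) (p : M) (A : 'M[R]_n) (v : 'rV[R]_n) :
  immersion_in_sphere F -> unit_normal_field F eta -> atlas M c -> dom c p ->
  shape_matrix c F eta p A ->
  dot (chart_derive c eta p v) (F p) = 0 /\
  chart_derive c eta p v = - chart_derive c F p (v *m A).
Proof.
move=> [F1 sF _] [seta _ etaF etadF] ac cp shA.
have Dp : (coord c @` dom c) (coord c p) by exists p.
have [dF _] := sF c ac 1%N; have [deta _] := seta c ac 1%N.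
have D0 : dot (chart_derive c eta p v) (F p) = 0.
  have H := is_derive_dot v (deta _ Dp) (dF _ Dp).
  have E0 : (fun u => dot ((eta \o par c) u) ((F \o par c) u)) = cst 0.
    by apply/funext => u; exact: etaF.
  have := @derive_val _ _ _ _ _ _ _ H; rewrite E0 derive_cst /= coordK_on //.
  by rewrite -/(chart_derive c F p v) etadF // addr0 => /esym.
split=> //; have := shA v.
rewrite /sphere_covariant_derive /sphere_tangent_part D0 scale0r subr0 => ->.
by rewrite opprK.
Qed.

Section Transported.
Variables (n : nat) (M : smoothManifold R n) (F eta : M -> 'rV[R]_n.+2).
Variable (y : 'rV[R]_n.+2).
Hypothesis F_immersion : immersion_in_sphere F.
Hypothesis eta_normal : unit_normal_field F eta.
Hypothesis y1 : dot y y = 1.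
Hypothesis not_antipodal : forall p, -1 < dot (F p) y.

Definition transported_normal p := transport (F p) y (eta p).

Let F1 p : dot (F p) (F p) = 1.
Proof. by have [H _ _] := F_immersion; have := H p; rewrite usphereE. Qed.

Let eta1 p : dot (eta p) (eta p) = 1.
Proof. by have [_ H _ _] := eta_normal; rewrite -enorm_sqr H expr1n. Qed.

Let etaF p : dot (eta p) (F p) = 0.
Proof. by have [_ _ H _] := eta_normal. Qed.

Lemma transported_normal_unit p :
  dot (transported_normal p) y = 0 /\
  dot (transported_normal p) (transported_normal p) = 1.
Proof.
by rewrite -(eta1 p); exact: transport_isometry.
Qed.

Let height p := - (dot (eta p) y / (1 + dot (F p) y)).

Let transportedE (c : chart R n M) : transported_normal \o par c =
  fun u => (eta \o par c) u + (height \o par c) u *: ((F \o par c) u + y).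
Proof. by apply/funext => u; rewrite /= /transported_normal /transport scaleNr. Qed.

Let height_smooth (c : chart R n M) k : atlas M c ->
  Ck_on k (coord c @` dom c) (height \o par c).
Proof.
move=> ac; have oD := @codom_open _ _ _ c.
have [_ sF _] := F_immersion; have [seta _ _ _] := eta_normal.
apply: (Ck_on_opp oD); apply: (Ck_on_mul oD).
  exact: (Ck_on_dot oD (seta c ac k) (Ck_on_cst k _ y)).
apply: (Ck_on_inv oD) => [u _|].
  by rewrite gt_eqF //=; have := not_antipodal (par c u); lra.
apply: (Ck_on_add oD); first exact: Ck_on_cst.
exact: (Ck_on_dot oD (sF c ac k) (Ck_on_cst k _ y)).
Qed.

Lemma transported_normal_smooth : smooth_map transported_normal.
Proof.
move=> c ac k; have oD := @codom_open _ _ _ c.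
have [_ sF _] := F_immersion; have [seta _ _ _] := eta_normal.
rewrite transportedE; apply: (Ck_on_add oD (seta c ac k)).
apply: (Ck_on_scale oD (height_smooth k ac)).
exact: (Ck_on_add oD (sF c ac k) (Ck_on_cst k _ y)).
Qed.

(** If the differential kills v, then d eta(v) - h dF(v) = dh(v) (F + y).  The left
  side is orthogonal to F while F + y is not, so dh(v) = 0, and then
  v A + h v = 0 by the Weingarten equation: - h would be an eigenvalue. *)
Lemma transported_normal_immersive (c : chart R n M) p (A : 'M[R]_n) v :
  atlas M c -> dom c p -> shape_matrix c F eta p A ->
  ~~ eigenvalue A (- (dot (eta p) y / (1 + dot (F p) y))) ->
  chart_derive c transported_normal p v = 0 -> v = 0.
Proof.
move=> ac cp shA nev; rewrite /chart_derive transportedE.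
have Dp : (coord c @` dom c) (coord c p) by exists p.
have [_ sF injF] := F_immersion; have [seta _ _ etadF] := eta_normal.
have [dF _] := sF c ac 1%N; have [deta _] := seta c ac 1%N.
have [dh _] := height_smooth 1 ac.
have dFy : differentiable (fun u => (F \o par c) u + y) (coord c p).
  exact: (differentiableD (dF _ Dp) (differentiable_cst y _)).
have [dhF DhF] := derive_scale v (dh _ Dp) dFy.
have DFy : 'D_v (fun u => (F \o par c) u + y) (coord c p) = chart_derive c F p v.
  have := deriveD (diff_derivable (v := v) (dF _ Dp)) (derivable_cst y (coord c p) v).
  by rewrite derive_cst addr0.
have -> : 'D_v (fun u => (eta \o par c) u + (height \o par c) u *: ((F \o par c) u + y))
      (coord c p) = chart_derive c eta p v +
    ('D_v (height \o par c) (coord c p) *: (F p + y) + height p *: chart_derive c F p v).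
  apply: etrans (deriveD (diff_derivable (v := v) (deta _ Dp)) (diff_derivable dhF)) _.
  by rewrite DhF DFy /= coordK_on.
set dhv := 'D_v (height \o par c) _.
have [D0 De] := derive_normal v F_immersion eta_normal ac cp shA.
have DF0 : dot (chart_derive c F p v) (F p) = 0.
  have := @dot_derive_unit R _ _ (F \o par c) (coord c p) v (dF _ Dp).
  rewrite /= coordK_on //; apply.
  by near=> u; exact: F1.
move=> H; have := congr1 (fun w => dot w (F p)) H.
rewrite !dotE D0 DF0 F1 mulr0 addr0 add0r (dotC y) => /eqP.
rewrite mulf_eq0 => /orP[|/eqP Fy]; last by exfalso; have := not_antipodal p; lra.
move=> /eqP dhv0; move: H; rewrite dhv0 scale0r add0r De => H.
have dlin : differentiable (F \o par c) (coord c p) := dF _ Dp.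
have : chart_derive c F p (v *m A - height p *: v) = 0.
  move: H; rewrite /chart_derive !deriveE // linearB linearZ /= => H.
  by apply/eqP; rewrite -oppr_eq0 opprB addrC H.
move=> /(injF c p ac cp) /eqP; rewrite subr_eq0 => /eqP vA.
apply/eqP; apply: contraNT nev => v0.
by apply/eigenvalueP; exists v.
Unshelve. all: by end_near. Qed.

End Transported.

End ShapeOperator.

Theorem theorem1 (R : realType) (n : nat) (hn : (2 <= n)%N)
    (M : smoothManifold R n)
    (M_compact : compact [set: M]) (M_connected : connected [set: M])
    (F : M -> 'rV[R]_n.+2) (F_immersion : immersion_in_sphere F)
    (eta : M -> 'rV[R]_n.+2) (eta_normal : unit_normal_field F eta)
    (rho : R) (rho_bounds : 0 < rho < pi)
    (rho_smallest : smallest_ball_radius (range F) rho)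
    (lambda : 'I_n -> M -> R)
    (lambda_curvatures :
       forall p : M, principal_curvatures_at F eta p (fun i => lambda i p))
    (lambda_large :
       forall i : 'I_n,
         tan (rho / 2) < inf (range (fun p : M => `|lambda i p|))) :
  diffeomorphic_to M (usphere R n.+1).
Proof.
have [[y Sy ball_y] smallest] := rho_smallest.
(* On the empty manifold every radius would do, contradicting 0 < rho. *)
have [p0 _] : exists p0 : M, True.
  apply: contrapT => noM; have /andP[rho0 _] := rho_bounds.
  have := smallest y 0 Sy; rewrite leNgt rho0 => /(_ _)/negP; apply=> //.
  by move=> x [p _]; case: noM; exists p.
have y1 : dot y y = 1 by rewrite -usphereE.
have F1 p : dot (F p) (F p) = 1.
  by have [H _ _] := F_immersion; rewrite -usphereE.
have cap p : cos rho <= dot (F p) y.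
  have Fp : range F (F p) by exists p.
  exact: (geodesic_ball_cap (leqW hn : (2 < n.+2)%N) rho_bounds Sy (ball_y _ Fp)).
have not_antipodal p : -1 < dot (F p) y.
  exact: lt_le_trans (cos_gtN1 rho_bounds) (cap p).
have lambdaP i p : tan (rho / 2) < `|lambda i p|.
  apply: lt_le_trans (lambda_large i) _; apply: ge_inf; last by exists p.
  by exists 0 => x [q _ <-].
pose G := transported_normal F eta y.
have Gunit p := transported_normal_unit F_immersion eta_normal y1 not_antipodal p.
have sG := transported_normal_smooth F_immersion eta_normal not_antipodal.
have [B HB] := hyperplane_isometry y1.
apply: (@immersion_to_sphere_diffeomorphic R n hn M p0 (fun p => G p *m B)) => //.
- by move=> c ac k; apply: Ck_on_mulmxr; [exact: codom_open|exact: sG].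
- by move=> p; have [Gy G1] := Gunit p; rewrite HB.
move=> p; have [c [A [ac cp shA charA]]] := lambda_curvatures p.
exists c; split=> // v; rewrite /chart_derive.
have Dp : (coord c @` dom c) (coord c p) by exists p.
have [dG _] := sG c ac 1%N.
have [_ DGB] := derive_mulmxr B (dG _ Dp).
have -> : 'D_v ((fun q => G q *m B) \o par c) (coord c p) =
    chart_derive c G p v *m B by exact: DGB.
have DGy : dot (chart_derive c G p v) y = 0.
  have H := is_derive_dot v (dG _ Dp) (differentiable_cst y (coord c p)).
  have E0 : (fun u => dot ((G \o par c) u) (cst y u)) = cst 0.
    by apply/funext => u; have [] := Gunit (par c u).
  have := @derive_val _ _ _ _ _ _ _ H.
  by rewrite E0 !derive_cst dot0r addr0 => /esym.
move=> DGB0; apply: (transported_normal_immersive F_immersion eta_normal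
  not_antipodal ac cp shA).
- rewrite eigenvalue_root_char charA rootE horner_prod.
  apply/prodf_neq0 => i _; rewrite hornerXsubC subr_eq0; apply/eqP => E.
  have := lambdaP i p; rewrite -E normrN ltNge.
  have [_ eta1 etaF _] := eta_normal.
  by rewrite half_angle_bound // -enorm_sqr eta1 expr1n.
- apply/eqP; rewrite -dot_eq0 -(HB _ DGy).
  by rewrite DGB0 dot0l.
Qed.
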